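(* Let $M\ge 3$, $2<K<\frac{M}{2}$, and let $\mathcal{S}$ be the collection of all subsets of $\{1,\dots,M\}$ of size at most $K$. Consider the outlier hypothesis testing problem with identical outliers described in the context, in the setting where neither $\mu$ nor $\pi$ is known. For each threshold $T$, let $(N^*,\delta^* )$ be the universal test with parameter $T$ described in the context, and let $P_{\max}$ be its maximal error probability. Then this test is universally consistent as $T\to\infty$, and for all $\mu,\pi\in\mathcal{P}(\mathcal{Y})$ with full support and $\mu\neq\pi$ it satisfies, for every $T$, $$P_{\max}\le\frac{C}{T},$$ where $C$ is a constant that depends on $M,K,\mu,\pi$, but not on $T$. In addition, for each non-null hypothesis $S\in\mathcal{S}$, $S\ne\emptyset$, as $T\to\infty$, $$\mathbb{E}_S[N^*]\le\frac{\log T}{\overline{\alpha}_S}(1+o(1))\le\begin{cases}\dfrac{-\log P_{\max}}{\overline{\eta}_S(\mu\|\pi)}(1+o(1)), & |S|=K,\\[2mm]\dfrac{-\log P_{\max}}{\min\left(\overline{\eta}_S(\mu\|\pi),\,\eta_S(\mu\|\pi)\right)}(1+o(1)), & 1\le|S|<K,\end{cases}$$ where $$\overline{\alpha}_S\triangleq\min_{S'\in\mathcal{S},\,S'\ne S,\,S'\ne\emptyset}\Big[\,|S\cap S'|\,D\Big(\mu\Big\|\tfrac{|S\cap S'|\mu+|S'\setminus S|\pi}{|S'|}\Big)+|S\setminus S'|\,D\Big(\mu\Big\|\tfrac{|S\setminus S'|\mu+|S^c\cap S'^c|\pi}{M-|S'|}\Big)$$ $$\qquad+|S'\setminus S|\,D\Big(\pi\Big\|\tfrac{|S\cap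 S'|\mu+|S'\setminus S|\pi}{|S'|}\Big)+|S^c\cap S'^c|\,D\Big(\pi\Big\|\tfrac{|S\setminus S'|\mu+|S^c\cap S'^c|\pi}{M-|S'|}\Big)\Big]>0,$$ $$\overline{\eta}_S(\mu\|\pi)\triangleq\min_{p\in\mathcal{P}(\mathcal{Y})}D(\mu\|p)+(M-K-|S|)\,D(\pi\|p),\qquad \eta_S(\mu\|\pi)\triangleq\min_{p\in\mathcal{P}(\mathcal{Y})}|S|\,D(\mu\|p)+D(\pi\|p).$$
   Context: All logarithms are natural. $\mathcal{Y}$ is a finite known set, $\mathcal{P}(\mathcal{Y})$ is the set of probability distributions on $\mathcal{Y}$, and $D(p\|q)=\sum_{y\in\mathcal{Y}}p(y)\log\frac{p(y)}{q(y)}$ is relative entropy. Complements $S^c$ are taken in $\{1,\dots,M\}$. Model. There are $M\ge 3$ independent sequences of observations; $Y^{(i)}_k\in\mathcal{Y}$ is the $k$-th observation of the $i$-th sequence, and each sequence is i.i.d. There are at most $K$ outliers, $2<K<M/2$. Let $\mu,\pi\in\mathcal{P}(\mathcal{Y})$ have full support, $\mu\ne\pi$ (otherwise arbitrary). Under the hypothesis $S\in\mathcal{S}$ ($S$ is the set of all outliers), sequences $i\in S$ are i.i.d. $\mu$ and sequences $j\notin S$ are i.i.d. $\pi$, so the first $n$ observations $\mathbf{y}^n$ of all sequences have joint law $$p_S(\mathbf{y}^n)=\prod_{k=1}^n\Big\{\prod_{i\in S}\mu(y^{(i)}_k)\prod_{j\notin S}\pi(y^{(j)}_k)\Big\}.$$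 $S=\emptyset$ is the null hypothesis. $\mathbb{P}_S,\mathbb{E}_S$ denote probability and expectation under hypothesis $S$. A sequential test is a pair $(N,\delta)$ of a stopping time $N$ and a decision rule $\delta$ which, on $N=n$, maps the first $n$ observations of all sequences to an element of $\mathcal{S}$. Its maximal error probability is $P_{\max}=\max_{S\in\mathcal{S}}\mathbb{P}_S\{\delta(\mathbf{Y}^N)\ne S\}$. A family of tests indexed by $T$ is universally consistent if $P_{\max}\to0$ as $T\to\infty$ for all $\mu,\pi$ with $\mu\ne\pi$. The test. At time $n$ let $\gamma_i$ be the empirical distribution of the first $n$ observations of sequence $i$. For nonempty $S\in\mathcal{S}$ put $$G_n(S)=\sum_{i\in S}D\Big(\gamma_i\,\Big\|\,\tfrac{1}{|S|}\sum_{k\in S}\gamma_k\Big)+\sum_{j\notin S}D\Big(\gamma_j\,\Big\|\,\tfrac{1}{M-|S|}\sum_{k\notin S}\gamma_k\Big),$$ and let $\hat S=\hat S(\mathbf{Y}^n)\in\operatorname{argmin}_{S\in\mathcal{S},S\ne\emptyset}G_n(S)$ (equivalently, the maximizer over nonempty $S \in \mathcal S$ of the generalized likelihood obtained from $p_S$ by replacing $\mu$ with $\frac{1}{|S|}\sum_{i\in S}\gamma_i$ and $\pi$ with $\frac1{M-|S|}\sum_{j\notin S}\gamma_j$). Let $\tilde N$ be the smallest $n\ge1$ such that $$\min_{S'\in\mathcal{S},\,S'\ne\hat S,\,S'\ne\emptyset}\ n\big[G_n(S')-G_n(\hat S)\big]>\log T+(M+1)|\mathcal{Y}|\log(n+1).$$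 Let $f(T)$ be any function growing at least as fast as $T\log T$. The test is $N^*=\min(\tilde N,\lfloor f(T)\rfloor)$, with $\delta^*=\hat S(\mathbf{Y}^{N^*})$ if $\tilde N\le f(T)$, and $\delta^*=\emptyset$ (the null hypothesis) if $\tilde N>f(T)$. *)

(* Defs.v *)
From HB Require Import structures.
From mathcomp Require Export all_boot all_order all_algebra.
From mathcomp Require Export all_classical all_reals all_analysis.
Export Order.TTheory GRing.Theory Num.Theory.
Export numFieldNormedType.Exports.

Set Implicit Arguments.
Unset Strict Implicit.
Unset Printing Implicit Defensive.

Local Open Scope classical_set_scope.
Local Open Scope ring_scope.

Section distributions.
Context {R : realType} {A : finType}.
Implicit Types p q : A -> R.

Definition pmf p : Prop := (forall a, 0 <= p a) /\ \sum_a p a = 1.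

Definition full_support p : Prop := forall a, 0 < p a.

(* Extended-real valued, since the minima defining [eta] and [eta_bar] range
   over distributions without full support. *)
Definition rel_entropy p q : \bar R :=
  (\sum_a (if p a == 0%R then 0 else
           if q a == 0%R then +oo else (p a * ln (p a / q a))%:E))%E.

End distributions.

Section observations.
Context {M : nat} {A : finType}.

(* [x k i] is the (k+1)-st observation of sequence i. *)
Definition path := nat -> 'I_M -> A.
Definition obs n := {ffun 'I_n -> {ffun 'I_M -> A}}.
Definition prefix n (x : path) : obs n :=
  [ffun k : 'I_n => [ffun i : 'I_M => x k i]].

(* The collection of admissible outlier sets. *)
Definition hypothesis K (S : {set 'I_M}) : bool := (#|S| <= K)%N.
Definition nonnull K (S : {set 'I_M}) : bool := hypothesis K S && (S != finset.set0).

End observations.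
Arguments path : clear implicits.
Arguments obs : clear implicits.

(* The adaptedness conditions say that whether the test stops at time n, and
   its decision in that case, depend on the first n observations only. *)
Record seq_test (M : nat) (A : finType) (K : nat) := SeqTest {
  stop : path M A -> nat;
  decide : path M A -> {set 'I_M};
  stop_adapted : forall x y,
    prefix (stop x) x = prefix (stop x) y -> stop y = stop x;
  decide_adapted : forall x y,
    prefix (stop x) x = prefix (stop x) y -> decide y = decide x;
  decide_hypothesis : forall x, hypothesis K (decide x) }.

Section model.
Context {R : realType} {M : nat} {A : finType}.
Implicit Types (mu pi : A -> R) (S : {set 'I_M}).

Definition joint_pmf mu pi S n (y : obs M A n) : R :=
  \prod_(k < n) ((\prod_(i in S) mu (y k i)) * (\prod_(j | j \notin S) pi (y k j))).

(* One sample space carrying the observations, with one probability measure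
   for each hypothesis. *)
Record outlier_model K mu pi d (Omega : measurableType d)
    (P : {set 'I_M} -> probability Omega R) (Y : Omega -> path M A) : Prop := {
  model_measurable : forall k i a, measurable [set w | Y w k i = a];
  model_law : forall S, hypothesis K S -> forall n (y : obs M A n),
    P S [set w | prefix n (Y w) = y] = (joint_pmf mu pi S y)%:E }.

Definition P_max K d (Omega : measurableType d)
    (P : {set 'I_M} -> probability Omega R) (Y : Omega -> path M A)
    (t : seq_test M A K) : R :=
  \big[Num.max/0]_(S | hypothesis K S)
    fine (P S [set w | decide t (Y w) <> S]).

Definition universally_consistent K (t : R -> seq_test M A K) : Prop :=
  forall mu pi, pmf mu -> pmf pi -> mu <> pi ->
  forall d (Omega : measurableType d)
    (P : {set 'I_M} -> probability Omega R) (Y : Omega -> path M A),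
  outlier_model K mu pi P Y ->
  P_max P Y (t T) @[T --> +oo] --> (0 : R).

End model.

Section test.
Context (R : realType) {M : nat} {A : finType}.

Definition empirical n (y : obs M A n) (i : 'I_M) (a : A) : R :=
  #|[set k | y k i == a]%SET|%:R / n%:R.

Definition pooled n (y : obs M A n) (B : {set 'I_M}) (a : A) : R :=
  (\sum_(k in B) empirical y k a) / #|B|%:R.

Definition G n (y : obs M A n) (S : {set 'I_M}) : \bar R :=
  (\sum_(i in S) rel_entropy (empirical y i) (pooled y S) +
   \sum_(j in ~: S) rel_entropy (empirical y j) (pooled y (~: S)))%E.

(* A selection from the argmin of G; ties are broken arbitrarily. *)
Record ml_rule K := MLRule {
  S_hat :> forall n, obs M A n -> {set 'I_M};
  S_hat_nonnull : forall n (y : obs M A n), (0 < n)%N -> nonnull K (S_hat y);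
  S_hat_min : forall n (y : obs M A n), (0 < n)%N ->
    forall S, nonnull K S -> (G y (S_hat y) <= G y S)%E }.

Definition crosses K (Sh : ml_rule K) (T : R) n (y : obs M A n) : bool :=
  (0 < n)%N &&
  ((ln T + (M.+1 * #|A|)%:R * ln n.+1%:R)%:E <
   \big[mine/+oo]_(S | nonnull K S && (S != Sh n y))
      (n%:R%:E * (G y S - G y (Sh n y))))%E.

(* The least time at which b holds, [None] standing for infinity. *)
Definition first_time (b : nat -> bool) : option nat :=
  if pselect (exists n, b n) is left h then Some (ex_minn h) else None.

Lemma first_time_some b n :
  first_time b = Some n <-> b n /\ forall j, (j < n)%N -> ~~ b j.
Proof.
rewrite /first_time; case: pselect => [h|h]; last first.
  by split=> // -[bn _]; case: h; exists n.
case: ex_minnP => m bm hm; split=> [[<-]|[bn hn]].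
  by split=> // j jm; apply: contraTN jm => /hm; rewrite -leqNgt.
congr Some; apply/eqP; rewrite eqn_leq hm //= leqNgt.
by apply/negP => /hn; rewrite bm.
Qed.

Lemma first_time_none b : first_time b = None <-> forall n, ~~ b n.
Proof.
rewrite /first_time; case: pselect => [[n bn]|h]; split=> //.
  by move=> /(_ n); rewrite bn.
by move=> _ n; apply/negP => bn; apply: h; exists n.
Qed.

Definition N_tilde K (Sh : ml_rule K) (T : R) (x : path M A) : option nat :=
  first_time (fun n => crosses Sh T (prefix n x)).

(* F stands for f(T); [Num.truncn F] is the floor of F, or 0 if F < 0, in which
   case the test stops at time 0 with the null decision. *)
Definition N_star K (Sh : ml_rule K) (T F : R) (x : path M A) : nat :=
  if N_tilde Sh T x is Some n then minn n (Num.truncn F) else Num.truncn F.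

Definition delta_star K (Sh : ml_rule K) (T F : R) (x : path M A) : {set 'I_M} :=
  if N_tilde Sh T x is Some n then
    if n%:R <= F then Sh _ (prefix (N_star Sh T F x) x) else finset.set0
  else finset.set0.

Lemma prefix_le m n (x y : path M A) : (m <= n)%N ->
  prefix n x = prefix n y -> prefix m x = prefix m y.
Proof.
move=> mn /ffunP e; apply/ffunP => k; apply/ffunP => i; rewrite !ffunE.
by have /ffunP /(_ i) := e (widen_ord mn k); rewrite !ffunE.
Qed.

Lemma N_tilde_gt0 K (Sh : ml_rule K) T x n : N_tilde Sh T x = Some n -> (0 < n)%N.
Proof. by move=> /first_time_some[/andP[]]. Qed.

Lemma truncn_geN (F : R) n : (0 < n)%N -> (n%:R <= F) = (n <= Num.truncn F)%N.
Proof.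
move=> n0; have [F0|F0] := leP 0 F; first by rewrite truncn_ge_nat.
have -> : Num.truncn F = 0%N by apply/truncn0Pn; rewrite -ltNge (lt_trans F0).
by rewrite leqn0 (gtn_eqF n0) leNgt (lt_le_trans F0).
Qed.

Lemma N_tilde_adapted K (Sh : ml_rule K) T F x y :
    prefix (N_star Sh T F x) x = prefix (N_star Sh T F x) y ->
  (exists n, [/\ N_tilde Sh T x = Some n, N_tilde Sh T y = Some n &
                 (n <= Num.truncn F)%N]) \/
  ((forall n, N_tilde Sh T x = Some n -> (Num.truncn F < n)%N) /\
   (forall n, N_tilde Sh T y = Some n -> (Num.truncn F < n)%N)).
Proof.
rewrite /N_star; case E: (N_tilde Sh T x) => [n|] e.
  have /first_time_some[cn hn] := E.
  have [nF|Fn] := leqP n (Num.truncn F).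
    left; exists n; split=> //; move: e; rewrite (minn_idPl nF) => e.
    apply/first_time_some; split; first by rewrite -e.
    by move=> j jn; rewrite -(prefix_le (ltnW jn) e) hn.
  right; split; first by move=> _ [<-].
  move: e; rewrite (minn_idPr (ltnW Fn)) => e m /first_time_some[cm _].
  rewrite ltnNge; apply/negP => mF.
  by move: cm; rewrite -(prefix_le mF e) (negbTE (hn _ (leq_ltn_trans mF Fn))).
right; split=> // m /first_time_some[cm _].
rewrite ltnNge; apply/negP => mF; move/first_time_none: E => /(_ m).
by rewrite (prefix_le mF e) cm.
Qed.

Lemma N_star_adapted K (Sh : ml_rule K) T F x y :
  prefix (N_star Sh T F x) x = prefix (N_star Sh T F x) y ->
  N_star Sh T F y = N_star Sh T F x.
Proof.
move=> /N_tilde_adapted[[n [ex ey _]]|[hx hy]]; rewrite /N_star.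
  by rewrite ex ey.
case ey: (N_tilde Sh T y) hy => [n|] hy; case ex: (N_tilde Sh T x) hx => [m|] hx.
- by rewrite (minn_idPr (ltnW (hy _ erefl))) (minn_idPr (ltnW (hx _ erefl))).
- by rewrite (minn_idPr (ltnW (hy _ erefl))).
- by rewrite (minn_idPr (ltnW (hx _ erefl))).
- by [].
Qed.

Lemma delta_star_adapted K (Sh : ml_rule K) T F x y :
  prefix (N_star Sh T F x) x = prefix (N_star Sh T F x) y ->
  delta_star Sh T F y = delta_star Sh T F x.
Proof.
move=> e; have eN := N_star_adapted e.
have late z : (forall n, N_tilde Sh T z = Some n -> (Num.truncn F < n)%N) ->
    delta_star Sh T F z = finset.set0.
  rewrite /delta_star; case E: (N_tilde Sh T z) => [n|] // /(_ _ erefl) Fn.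
  by rewrite truncn_geN ?(N_tilde_gt0 E)// leqNgt Fn.
case: (N_tilde_adapted e) => [[n [ex ey nF]]|[hx hy]].
  by rewrite /delta_star ex ey eN e.
by rewrite !late.
Qed.

Lemma delta_star_hypothesis K (Sh : ml_rule K) T F x :
  hypothesis K (delta_star Sh T F x).
Proof.
rewrite /delta_star; case E: (N_tilde Sh T x) => [n|]; last first.
  by rewrite /hypothesis cards0.
have n0 := N_tilde_gt0 E; rewrite truncn_geN//.
case: ifP => nF; last by rewrite /hypothesis cards0.
suff N0 : (0 < N_star Sh T F x)%N by have /andP[] := S_hat_nonnull Sh (prefix _ x) N0.
by rewrite /N_star E (minn_idPl nF).
Qed.

Definition universal_test K (Sh : ml_rule K) (T F : R) : seq_test M A K :=
  SeqTest (@N_star_adapted K Sh T F) (@delta_star_adapted K Sh T F)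
          (delta_star_hypothesis Sh T F).

End test.
Arguments ml_rule : clear implicits.

(* f(T) = Omega(T log T), with explicit constants so that bounds can be stated
   uniformly in f. *)
Definition grows_TlogT {R : realType} (c T0 : R) (f : R -> R) : Prop :=
  forall T, T0 <= T -> c * (T * ln T) <= f T.

Section exponents.
Context {R : realType} {M : nat} {A : finType}.
Implicit Types (mu pi : A -> R) (S : {set 'I_M}).

Definition mixture (a b m : nat) mu pi (x : A) : R :=
  (a%:R * mu x + b%:R * pi x) / m%:R.

Definition alpha_bar K mu pi S : \bar R :=
  (\big[mine/+oo]_(S' : {set 'I_M} | nonnull K S' && (S' != S))
    let m1 := mixture #|S :&: S'| #|S' :\: S| #|S'| mu pi in
    let m2 := mixture #|S :\: S'| #|~: S :&: ~: S'| (M - #|S'|) mu pi in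
    (#|S :&: S'|%:R%:E * rel_entropy mu m1 +
     #|S :\: S'|%:R%:E * rel_entropy mu m2 +
     #|S' :\: S|%:R%:E * rel_entropy pi m1 +
     #|~: S :&: ~: S'|%:R%:E * rel_entropy pi m2))%E.

(* [ereal_inf] is a minimum here: rel_entropy is lower semicontinuous in its
   second argument and the simplex is compact. *)
Definition eta_bar K mu pi S : \bar R :=
  ereal_inf [set (rel_entropy mu p + (M - K - #|S|)%:R%:E * rel_entropy pi p)%E
            | p in pmf].

Definition eta mu pi S : \bar R :=
  ereal_inf [set (#|S|%:R%:E * rel_entropy mu p + rel_entropy pi p)%E
            | p in pmf].

End exponents.

(* Main.v *)
Require Import Defs.
From mathcomp Require Import ring lra zify measurable_realfun.

Set Implicit Arguments.
Unset Strict Implicit.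
Unset Printing Implicit Defensive.

Local Open Scope classical_set_scope.
Local Open Scope ring_scope.

(** Let [S] be the true set of outliers and let the statistic [G] be read as
    [split_div]: the total divergence of the empirical distributions from the
    averages of the two groups that a candidate set determines. Everything
    rests on three facts.

    First, averages minimize the total divergence of a group
    ([sum_kl_ge_pool]). Hence [G y S] is at most the divergence of the
    empirical distributions from the true ones, and under the null hypothesis
    the same holds of [G y S'] for every nonempty [S']. If the test stops at
    time [n] on a wrong set, some such statistic exceeds the threshold divided
    by [n] ([crosses_wrong]). By the method of types ([prob_divergence_ge]) this has
    probability at most [(n+1)^(M * #|A|) * exp (- threshold)], which is at
    most [1 / (T * (n+1)^2)]: the term [(M+1) * #|A| * ln (n+1)] in the
    threshold pays for the number of types, and what remains is summable since
    [A] has at least two elements. So a wrong stop has probability at most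
    [2 / T], for all times together.

    Secondly, entropy is uniformly continuous ([shannon_modulus]), so the gaps
    [G y S' - G y S] are close to their values at the true distributions, the
    least of which is [alpha_bar], as soon as all empirical frequencies are
    close to the true probabilities. On that event the test stops once
    [n * (alpha_bar - e)] exceeds the threshold ([near_crosses]), and its
    complement has a probability exponentially small in [n] ([prob_far]), again
    by the method of types together with a lower bound of the divergence by the
    Hellinger distance. Since [f T] is at least of order [T * ln T], not having
    stopped by time [f T] has probability [O(1/T)] ([prob_error_O_inv]), and
    summing the exponential tail gives an expected duration of at most
    [ln T / (alpha_bar - e) + O(1)] ([expected_stop_le]). Neither argument
    needs full support, so the bound [O(1/T)] also gives universal consistency.

    Thirdly, each term of the minimum defining [alpha_bar] dominates [eta] when
    [S] is a proper subset of [S'], and [eta_bar] otherwise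
    ([eta_le_split_div]); the former is impossible when [#|S| = K]. As
    [- ln Pmax] is at least [ln T - ln C], the second bound on the duration
    follows. Full support is what makes [Pmax] positive ([P_max_gt0]), so that
    its logarithm is meaningful, and the exponents finite. *)

(** * Relative entropy, Hellinger distance and continuity of entropy *)

Section divergence.
Context {R : realType} {A : finType}.
Implicit Types p q r : A -> R.

(** Relative entropy as a real number. It agrees with [rel_entropy] as soon as
    [p] is dominated by [q]; elsewhere the conventions for [ln 0] make it
    meaningless. *)
Definition kl p q : R := \sum_a p a * (ln (p a) - ln (q a)).

(** Absolute continuity of [p] with respect to [q]. *)
Definition dominated p q : Prop := forall a, q a = 0 -> p a = 0.

(** Shannon entropy; the letter of probability 0 contributes 0. *)
Definition shannon p : R := \sum_a - (p a * ln (p a)).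

(** Squared Hellinger distance, up to a constant factor. *)
Definition hellinger p q : R := \sum_a (Num.sqrt (p a) - Num.sqrt (q a)) ^+ 2.

(** Comes from [ln u <= u - 1] at [u = sqrt (q / x)]. *)
Lemma kl_term_ge (x q : R) : 0 <= x -> 0 <= q -> (q = 0 -> x = 0) ->
  (Num.sqrt x - Num.sqrt q) ^+ 2 <= x * (ln x - ln q) - x + q.
Proof.
move=> x0 q0 qx; have [->|xN0] := eqVneq x 0.
  by rewrite sqrtr0 sub0r sqrrN sqr_sqrtr// mul0r subr0 add0r.
have xp : 0 < x by rewrite lt_def xN0.
have qp : 0 < q by rewrite lt_def q0 andbT; apply: contraNN xN0 => /eqP/qx ->.
set s := Num.sqrt x; set t := Num.sqrt q.
have sp : 0 < s by rewrite sqrtr_gt0.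
have tp : 0 < t by rewrite sqrtr_gt0.
have xE : x = s ^+ 2 by rewrite sqr_sqrtr.
have qE : q = t ^+ 2 by rewrite sqr_sqrtr.
have lnE : ln x - ln q = - 2 * ln (t / s).
  by rewrite xE qE !lnXn// ln_div ?posrE//; lra.
have hl : ln (t / s) <= t / s - 1.
  have := @le_ln1Dx R (t / s - 1); rewrite addrCA subrr addr0; apply.
  by rewrite ltrBrDr addrC subrr divr_gt0.
rewrite lnE; apply: (@le_trans _ _ (x * (- 2 * (t / s - 1)) - x + q)).
  rewrite xE qE le_eqVlt; apply/orP; left; apply/eqP.
  by field; rewrite gt_eqF.
rewrite lerD2r lerD2r ler_wpM2l//; lra.
Qed.

Lemma kl_ge_hellinger p q : pmf p -> pmf q -> dominated p q ->
  hellinger p q <= kl p q.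
Proof.
move=> [p0 p1] [q0 q1] pq.
have -> : kl p q = \sum_a (p a * (ln (p a) - ln (q a)) - p a + q a).
  by rewrite big_split sumrB/= p1 q1 addrNK.
by apply: ler_sum => a _; apply: kl_term_ge; [| |exact: pq].
Qed.

Lemma hellinger_ge0 p q : 0 <= hellinger p q.
Proof. by apply: sumr_ge0 => a _; rewrite sqr_ge0. Qed.

Lemma kl_ge0 p q : pmf p -> pmf q -> dominated p q -> 0 <= kl p q.
Proof. by move=> *; rewrite (le_trans (hellinger_ge0 p q))// kl_ge_hellinger. Qed.

Lemma kl_xx p : kl p p = 0.
Proof. by apply: big1 => a _; rewrite subrr mulr0. Qed.

Lemma pmf_le1 p a : pmf p -> p a <= 1.
Proof.
by move=> [p0 <-]; rewrite (bigD1 a)//= lerDl sumr_ge0.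
Qed.

Lemma sqr_dist_le_hellinger p q a : pmf p -> pmf q ->
  (p a - q a) ^+ 2 <= 4 * hellinger p q.
Proof.
move=> pp pq; have [p0 _] := pp; have [q0 _] := pq.
have hle : (Num.sqrt (p a) - Num.sqrt (q a)) ^+ 2 <= hellinger p q.
  by rewrite /hellinger (bigD1 a)//= lerDl sumr_ge0// => *; rewrite sqr_ge0.
have -> : p a - q a = (Num.sqrt (p a) - Num.sqrt (q a)) *
                      (Num.sqrt (p a) + Num.sqrt (q a)).
  by rewrite -subr_sqr !sqr_sqrtr.
rewrite exprMn mulrC; apply: ler_pM => //; rewrite ?sqr_ge0//.
have s1 : Num.sqrt (p a) <= 1 by rewrite -(@sqrtr1 R) ler_wsqrtr// pmf_le1.
have t1 : Num.sqrt (q a) <= 1 by rewrite -(@sqrtr1 R) ler_wsqrtr// pmf_le1.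
have s0 := sqrtr_ge0 (p a); have t0 := sqrtr_ge0 (q a).
rewrite (_ : 4 = 2 ^+ 2); last by lra.
rewrite lerXn2r ?nnegrE ?addr_ge0//; lra.
Qed.

Lemma hellinger_gt0 p q : pmf p -> pmf q -> p <> q -> 0 < hellinger p q.
Proof.
move=> pp pq pneq; rewrite lt_def hellinger_ge0 andbT; apply/eqP => h0.
apply: pneq; apply/funext => a; apply/eqP; rewrite -subr_eq0 -sqrf_eq0.
by rewrite eq_le sqr_ge0 andbT (le_trans (sqr_dist_le_hellinger a pp pq))// h0 mulr0.
Qed.

Lemma kl_gt0 p q : pmf p -> pmf q -> dominated p q -> p <> q -> 0 < kl p q.
Proof.
by move=> pp pq d pneq; apply: lt_le_trans (kl_ge_hellinger pp pq d); exact: hellinger_gt0.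
Qed.

(** The squared Hellinger distance satisfies a weak triangle inequality. *)
Lemma hellinger_triangle p q r :
  hellinger p q <= 2 * (hellinger p r + hellinger q r).
Proof.
rewrite /hellinger -big_split/= mulr_sumr; apply: ler_sum => a _.
have := sqr_ge0 (Num.sqrt (p a) + Num.sqrt (q a) - 2 * Num.sqrt (r a)).
rewrite !expr2; nra.
Qed.

Lemma rel_entropyE p q : (forall a, 0 <= p a) -> (forall a, 0 <= q a) ->
  dominated p q -> rel_entropy p q = (kl p q)%:E.
Proof.
move=> p0 q0 pq; rewrite /rel_entropy /kl -sumEFin; apply: eq_bigr => a _.
have [->|pN0] := eqVneq (p a) 0; first by rewrite mul0r.
have qN0 : q a != 0 by apply: contraNN pN0 => /eqP/pq ->.
by rewrite (negbTE qN0) ln_div// posrE lt_def ?pN0 ?qN0 ?p0 ?q0.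
Qed.

Lemma rel_entropy_oo p q a : q a = 0 -> p a <> 0 -> rel_entropy p q = +oo%E.
Proof.
move=> qa pa; rewrite /rel_entropy; apply/esum_eqyP => [b _|].
  by case: ifP => // _; case: ifP.
exists a; rewrite mem_index_enum qa eqxx; split=> //.
by case: ifP => // /eqP.
Qed.

Lemma rel_entropy_ge p q : pmf p -> pmf q ->
  ((hellinger p q)%:E <= rel_entropy p q)%E.
Proof.
move=> pp pq; have [d|nd] := pselect (dominated p q).
  by rewrite rel_entropyE ?lee_fin ?kl_ge_hellinger//; [case: pp|case: pq].
have [a [qa pa]] : exists a, q a = 0 /\ p a <> 0.
  apply: contrapT => h; apply: nd => a qa; apply: contrapT => pa.
  by apply: h; exists a.
by rewrite (rel_entropy_oo qa pa) leey.
Qed.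

Lemma rel_entropy_ge0 p q : pmf p -> pmf q -> (0 <= rel_entropy p q)%E.
Proof.
by move=> pp pq; apply: le_trans (rel_entropy_ge pp pq); rewrite lee_fin hellinger_ge0.
Qed.

End divergence.

Section entropy_modulus.
Context {R : realType}.

(* The summand of the entropy. *)
Let h (x : R) := - (x * ln x).

Let h_le t : 0 <= t -> t <= 1 -> h t <= 2 * Num.sqrt t.
Proof.
move=> t0 t1; rewrite /h; have [->|tN0] := eqVneq t 0.
  by rewrite mul0r oppr0 mulr_ge0.
have tp : 0 < t by rewrite lt_def tN0.
have sp : 0 < Num.sqrt t by rewrite sqrtr_gt0.
have tE : t = Num.sqrt t ^+ 2 by rewrite sqr_sqrtr.
move: sp tE; set s := Num.sqrt t => sp tE.
have hl : ln s^-1 <= s^-1 - 1.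
  have := @le_ln1Dx R (s^-1 - 1); rewrite addrCA subrr addr0; apply.
  by rewrite ltrBrDr addrC subrr invr_gt0.
rewrite lnV ?posrE// in hl.
have -> : - (t * ln t) = 2 * s ^+ 2 * (- ln s) by rewrite tE lnXn//; lra.
apply: (@le_trans _ _ (2 * s ^+ 2 * s^-1)).
  by rewrite ler_wpM2l ?mulr_ge0 ?sqr_ge0//; lra.
by rewrite expr2 mulrA mulfK ?gt_eqF.
Qed.

Let h_modulus_le x y : 0 <= x -> x <= y -> y <= 1 ->
  `|h x - h y| <= 2 * Num.sqrt (y - x).
Proof.
move=> x0 xy y1; have [->|xy'] := eqVneq x y.
  by rewrite !subrr normr0 sqrtr0 mulr0.
have ltxy : x < y by rewrite lt_def eq_sym xy'.
set t := y - x; have tp : 0 < t by rewrite subr_gt0.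
have t1 : t <= 1 by rewrite /t; lra.
have yp : 0 < y by lra.
have yE : y = x + t by rewrite /t; lra.
have ts : t <= Num.sqrt t.
  rewrite -{1}(sqr_sqrtr (ltW tp)) expr2 ler_piMl ?sqrtr_ge0//.
  by rewrite -(@sqrtr1 R) ler_wsqrtr.
have ht := h_le (ltW tp) t1.
have lnty : ln t <= ln y by rewrite ler_ln ?posrE//; lra.
have lny : ln y <= 0 by rewrite ln_le0.
have xb : 0 <= x * (ln y - ln x) /\ x * (ln y - ln x) <= t.
  have [->|xN0] := eqVneq x 0; first by rewrite !mul0r; split; lra.
  have xp : 0 < x by rewrite lt_def xN0.
  split; first by rewrite mulr_ge0// subr_ge0 ler_ln ?posrE.
  rewrite -ln_div ?posrE//.
  have -> : y / x = 1 + t / x by rewrite yE mulrDl divff.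
  have : ln (1 + t / x) <= t / x by rewrite le_ln1Dx// (@lt_trans _ _ 0) ?divr_gt0//; lra.
  by move=> /(ler_wpM2l x0); rewrite mulrCA divff// mulr1.
have [xb1 xb2] := xb.
have tl1 : t * ln t <= t * ln y by rewrite ler_pM2l.
have tl2 : t * ln y <= 0 by rewrite mulr_ge0_le0 ?(ltW tp).
have hE : h x - h y = x * (ln y - ln x) + t * ln y by rewrite /h {1}yE; ring.
rewrite hE ler_norml; move: ht; rewrite /h => ht; apply/andP; split; lra.
Qed.

(** An explicit modulus of continuity of [x ln x] on the unit interval, end points
    included. *)
Lemma xlnx_modulus (x y : R) : 0 <= x <= 1 -> 0 <= y <= 1 ->
  `|- (x * ln x) - - (y * ln y)| <= 2 * Num.sqrt `|x - y|.
Proof.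
move=> /andP[x0 x1] /andP[y0 y1]; have [xy|/ltW yx] := leP x y.
  by rewrite distrC (distrC x) (ger0_norm (x := y - x)) ?subr_ge0// distrC; exact: h_modulus_le.
by rewrite distrC (ger0_norm (x := x - y)) ?subr_ge0//; exact: h_modulus_le.
Qed.

End entropy_modulus.

Lemma shannon_modulus (R : realType) (A : finType) (p q : A -> R) (d : R) :
  pmf p -> pmf q -> (forall a, `|p a - q a| <= d) ->
  `|shannon p - shannon q| <= 2 * #|A|%:R * Num.sqrt d.
Proof.
move=> pp pq hd; rewrite /shannon -sumrB (le_trans (ler_norm_sum _ _ _))//.
apply: (@le_trans _ _ (\sum_(a in A) 2 * Num.sqrt d)); last first.
  by rewrite sumr_const -[X in X <= _]mulr_natl mulrCA mulrA.
apply: ler_sum => a _; apply: (le_trans (xlnx_modulus _ _)).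
- by have [p0 _] := pp; rewrite p0 pmf_le1.
- by have [q0 _] := pq; rewrite q0 pmf_le1.
- by rewrite ler_wpM2l// ler_wsqrtr.
Qed.

(** * Divergence of a partition into two groups *)

Section two_group_divergence.
Context {R : realType} {M : nat} {A : finType}.
Implicit Types (q : 'I_M -> A -> R) (r mu pi : A -> R) (B S : {set 'I_M}).

(** The average of the distributions [q i] over the group [B]. *)
Definition pool q B (a : A) : R := (\sum_(k in B) q k a) / #|B|%:R.

(** Total divergence of the [q i] from the average of their own group, for the
    two groups [S] and its complement. Applied to empirical distributions it
    is the statistic [G]; applied to the true distributions under some
    hypothesis it is a term of the minimum defining [alpha_bar]. *)
Definition split_div q S : R :=
  \sum_(i in S) kl (q i) (pool q S) + \sum_(j in ~: S) kl (q j) (pool q (~: S)).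

(** Distribution of sequence [i] when the set of outliers is [S]. *)
Definition law mu pi S (i : 'I_M) : A -> R := if i \in S then mu else pi.

Lemma card_gt0R B : B != finset.set0 -> 0 < #|B|%:R :> R.
Proof. by move=> B0; rewrite ltr0n card_gt0. Qed.

Lemma pool_pmf q B : B != finset.set0 -> (forall i, pmf (q i)) -> pmf (pool q B).
Proof.
move=> B0 hq; split=> [a|].
  by rewrite divr_ge0// sumr_ge0// => i _; case: (hq i).
rewrite -mulr_suml exchange_big/= (eq_bigr (fun=> 1)); last first.
  by move=> i _; case: (hq i).
by rewrite sumr_const divff// gt_eqF// card_gt0R.
Qed.

Lemma pool_dominated q B i : (forall i, pmf (q i)) -> i \in B ->
  dominated (q i) (pool q B).
Proof.
move=> hq iB a /eqP; rewrite mulf_eq0 invr_eq0 pnatr_eq0 cards_eq0.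
move=> /orP[|/eqP B0]; last by rewrite B0 inE in iB.
by rewrite psumr_eq0 => [/allP/(_ i)|k _]; [rewrite mem_index_enum iB => /(_ isT)/eqP|case: (hq k)].
Qed.

Lemma pool_sum q B a : \sum_(k in B) q k a = #|B|%:R * pool q B a.
Proof.
have [->|B0] := eqVneq B finset.set0; first by rewrite big_set0 cards0 mul0r.
by rewrite /pool mulrC divfK// gt_eqF// card_gt0R.
Qed.

Lemma sum_kl q B r : \sum_(i in B) kl (q i) r =
  - (\sum_(i in B) shannon (q i)) - #|B|%:R * \sum_a pool q B a * ln (r a).
Proof.
rewrite mulr_sumr -[X in _ - X](_ : \sum_a \sum_(i in B) q i a * ln (r a) = _).
  rewrite [X in _ - X]exchange_big/= -!sumrN -big_split/=; apply: eq_bigr => i _.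
  rewrite /shannon -!sumrN -big_split/=; apply: eq_bigr => a _.
  by rewrite opprK mulrBr.
by apply: eq_bigr => a _; rewrite mulrA -pool_sum mulr_suml.
Qed.

Lemma sum_kl_pool q B : \sum_(i in B) kl (q i) (pool q B) =
  #|B|%:R * shannon (pool q B) - \sum_(i in B) shannon (q i).
Proof. by rewrite sum_kl /shannon !sumrN mulrN addrC. Qed.

(** The average minimizes the total divergence of a group. *)
Lemma sum_kl_ge_pool q B r : (forall i, pmf (q i)) -> pmf r ->
  (forall i, i \in B -> dominated (q i) r) ->
  \sum_(i in B) kl (q i) (pool q B) <= \sum_(i in B) kl (q i) r.
Proof.
move=> hq hr hd; have [->|B0] := eqVneq B finset.set0; first by rewrite !big_set0.
have dp : dominated (pool q B) r.
  by move=> a ra; rewrite /pool big1 ?mul0r// => i iB; rewrite (hd _ iB).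
have kge := kl_ge0 (pool_pmf B0 hq) hr dp.
have -> : \sum_(i in B) kl (q i) r =
    \sum_(i in B) kl (q i) (pool q B) + #|B|%:R * kl (pool q B) r.
  have -> : kl (pool q B) r = - shannon (pool q B) - \sum_a pool q B a * ln (r a).
    by rewrite /kl /shannon -!sumrN -big_split/=; apply: eq_bigr => a _; ring.
  by rewrite sum_kl sum_kl_pool; ring.
by rewrite lerDl mulr_ge0.
Qed.

Lemma sum_setC S (F : 'I_M -> R) :
  \sum_(i in S) F i + \sum_(j in ~: S) F j = \sum_i F i.
Proof.
rewrite [RHS](bigID (mem S))/=; congr (_ + _).
by apply: eq_bigl => i; rewrite inE.
Qed.

(** As a combination of entropies the statistic is visibly continuous, also
    where some probabilities vanish. *)
Lemma split_divE q S : split_div q S =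
  #|S|%:R * shannon (pool q S) + #|~: S|%:R * shannon (pool q (~: S))
  - \sum_i shannon (q i).
Proof.
by rewrite /split_div !sum_kl_pool -(sum_setC S (fun i => shannon (q i))); ring.
Qed.

Lemma split_div_ge0 q S : (forall i, pmf (q i)) ->
  S != finset.set0 -> ~: S != finset.set0 -> 0 <= split_div q S.
Proof.
move=> hq S0 SC0; rewrite addr_ge0// sumr_ge0// => i iS;
  by apply: kl_ge0 => //; [exact: pool_pmf|exact: pool_dominated].
Qed.

(** The empirical statistic is at most the divergence from any distributions
    [p i] that are constant on [S] and on its complement. *)
Lemma split_div_le q S (p : 'I_M -> A -> R) r1 r2 : (forall i, pmf (q i)) ->
  pmf r1 -> pmf r2 ->
  (forall i, i \in S -> p i = r1) -> (forall i, i \notin S -> p i = r2) ->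
  (forall i, dominated (q i) (p i)) ->
  split_div q S <= \sum_i kl (q i) (p i).
Proof.
move=> hq h1 h2 hS hSC hd; rewrite -(sum_setC S) lerD//.
  rewrite [leRHS](eq_bigr (fun i => kl (q i) r1)) => [|i iS]; last by rewrite hS.
  by apply: sum_kl_ge_pool => // i iS; rewrite -(hS i).
have hSC' i : i \in ~: S -> p i = r2 by rewrite inE => /hSC.
rewrite [leRHS](eq_bigr (fun i => kl (q i) r2)) => [|i iS]; last by rewrite hSC'.
by apply: sum_kl_ge_pool => // i iS; rewrite -(hSC' i).
Qed.

Lemma pool_dist q q' B (d : R) a : B != finset.set0 ->
  (forall i, `|q i a - q' i a| <= d) -> `|pool q B a - pool q' B a| <= d.
Proof.
move=> B0 hd; have b0 := card_gt0R B0.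
rewrite /pool -mulrBl -sumrB normrM (ger0_norm (x := _^-1)) ?invr_ge0// ler_pdivrMr//.
rewrite (le_trans (ler_norm_sum _ _ _))//.
apply: (@le_trans _ _ (\sum_(i in B) d)); first exact: ler_sum.
by rewrite sumr_const mulr_natr.
Qed.

Lemma split_div_modulus q q' S (d : R) :
  S != finset.set0 -> ~: S != finset.set0 ->
  (forall i, pmf (q i)) -> (forall i, pmf (q' i)) ->
  (forall i a, `|q i a - q' i a| <= d) ->
  `|split_div q S - split_div q' S| <= 4 * M%:R * #|A|%:R * Num.sqrt d.
Proof.
move=> S0 SC0 hq hq' hd; rewrite !split_divE.
set e := 2 * #|A|%:R * Num.sqrt d.
have hB B : B != finset.set0 ->
    `|#|B|%:R * shannon (pool q B) - #|B|%:R * shannon (pool q' B)| <= #|B|%:R * e.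
  move=> B0; rewrite -mulrBr normrM ger0_norm// ler_wpM2l//.
  by apply: shannon_modulus; [exact: pool_pmf|exact: pool_pmf|move=> a; exact: pool_dist].
have hI : `|\sum_i shannon (q i) - \sum_i shannon (q' i)| <= M%:R * e.
  rewrite -sumrB (le_trans (ler_norm_sum _ _ _))//.
  apply: (@le_trans _ _ (\sum_(i < M) e)); last by rewrite sumr_const card_ord mulr_natl.
  by apply: ler_sum => i _; exact: shannon_modulus.
have h1 := hB _ S0; have h2 := hB _ SC0.
have cM : M%:R = #|S|%:R + #|~: S|%:R :> R by rewrite -natrD cardsC card_ord.
have -> : 4 * M%:R * #|A|%:R * Num.sqrt d = (#|S|%:R * e + #|~: S|%:R * e) + M%:R * e.
  by rewrite -mulrDl -cM /e; ring.
move: h1 h2 hI.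
set x := _ * shannon (pool q S); set x' := _ * shannon (pool q' S).
set y := _ * shannon (pool q (~: S)); set y' := _ * shannon (pool q' (~: S)).
set z := \sum_i shannon (q i); set z' := \sum_i shannon (q' i).
set e1 := _ * e; set e2 := #|~: S|%:R * e; set e3 := M%:R * e.
by rewrite !ler_norml => /andP[? ?] /andP[? ?] /andP[? ?]; apply/andP; split; lra.
Qed.

Lemma law_pmf mu pi S i : pmf mu -> pmf pi -> pmf (law mu pi S i).
Proof. by rewrite /law; case: ifP. Qed.

Lemma sum_law (F : (A -> R) -> R) mu pi S B :
  \sum_(i in B) F (law mu pi S i) = #|S :&: B|%:R * F mu + #|B :\: S|%:R * F pi.
Proof.
rewrite (bigID (mem S))/= (eq_bigr (fun=> F mu)) => [|i /andP[_]]; last by rewrite /law => ->.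
rewrite [X in _ + X](eq_bigr (fun=> F pi)) => [|i /andP[_]]; last by rewrite /law => /negbTE ->.
rewrite (eq_bigl (mem (S :&: B))) => [|i]; last by rewrite !inE andbC.
rewrite [X in _ + X](eq_bigl (mem (B :\: S))) => [|i]; last by rewrite !inE andbC.
by rewrite !sumr_const -[X in X + _]mulr_natl -[X in _ + X]mulr_natl.
Qed.

Lemma pool_law mu pi S B :
  pool (law mu pi S) B = mixture #|S :&: B| #|B :\: S| #|B| mu pi.
Proof. by apply/funext => a; rewrite /pool (sum_law (fun f => f a)). Qed.

Lemma split_div_law_self mu pi S : pmf mu -> pmf pi ->
  S != finset.set0 -> ~: S != finset.set0 -> split_div (law mu pi S) S = 0.
Proof.
move=> hmu hpi S0 SC0; apply/eqP; rewrite eq_le split_div_ge0 ?andbT//; last first.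
  by move=> i; exact: law_pmf.
apply: (le_trans (@split_div_le _ S (law mu pi S) mu pi _ _ _ _ _ _)) => //.
- by move=> i; exact: law_pmf.
- by move=> i iS; rewrite /law iS.
- by move=> i /negbTE iS; rewrite /law iS.
- by move=> i a.
- by rewrite big1// => i _; rewrite kl_xx.
Qed.

Lemma mixture_neq a b m mu pi : (0 < a)%N -> (0 < b)%N -> m = (a + b)%N ->
  mu <> pi -> mixture a b m mu pi <> pi.
Proof.
move=> a0 b0 -> neq e; apply: neq; apply/funext => x.
have := congr1 (fun f => f x) e; rewrite /mixture => /eqP.
have ab : (a + b)%:R != 0 :> R by rewrite pnatr_eq0 addn_eq0 negb_and -!lt0n a0.
rewrite -(inj_eq (mulIf ab)) divfK// natrD mulrDr -subr_eq0 => /eqP h.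
have : a%:R * (mu x - pi x) = 0 by rewrite -h; ring.
by move=> /eqP; rewrite mulf_eq0 pnatr_eq0 gtn_eqF//= subr_eq0 => /eqP.
Qed.

(** A group that contains sequences of both kinds has positive divergence. *)
Lemma sum_kl_law_gt0 mu pi S B : pmf mu -> pmf pi -> mu <> pi ->
  (0 < #|S :&: B|)%N -> (0 < #|B :\: S|)%N ->
  0 < \sum_(i in B) kl (law mu pi S i) (pool (law mu pi S) B).
Proof.
move=> hmu hpi neq a0 b0; have hl i := @law_pmf mu pi S i hmu hpi.
have [j] : exists j, j \in B :\: S by apply/set0Pn; rewrite -card_gt0.
rewrite inE => /andP[jS jB]; have B0 : B != finset.set0 by apply/set0Pn; exists j.
rewrite (bigD1 j)//= ltr_wpDr//.
  rewrite sumr_ge0// => i /andP[iB _]; apply: kl_ge0 => //; first exact: pool_pmf.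
  exact: pool_dominated.
apply: kl_gt0; [exact: hl|exact: pool_pmf|exact: pool_dominated|].
rewrite {1}/law (negbTE jS) pool_law => /esym.
by apply: mixture_neq => //; rewrite -(cardsID S B) finset.setIC.
Qed.

(** More than half of the sequences are not outliers, so two admissible sets
    leave at least one sequence outside both. *)
Lemma card_setC_gt0 K S S' : (2 * K < M)%N -> (#|S| <= K)%N -> (#|S'| <= K)%N ->
  (M - K - #|S| <= #|~: S :&: ~: S'|)%N /\ (0 < M - K - #|S|)%N.
Proof.
move=> hKM cS cS'; split; last lia.
rewrite -finset.setCU [X in (_ <= X)%N]cardsCs finset.setCK card_ord.
have : (#|S :|: S'| <= #|S| + #|S'|)%N by rewrite cardsU leq_subr.
move: #|_ :|: _| => u; lia.
Qed.

Lemma nonnull_setC K S : (2 * K < M)%N -> nonnull K S ->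
  S != finset.set0 /\ ~: S != finset.set0.
Proof.
move=> hKM /andP[cS S0]; split=> //; rewrite -card_gt0 cardsCs finset.setCK card_ord.
by rewrite /hypothesis in cS; lia.
Qed.

Lemma exists_other K S : (2 < K)%N -> (2 * K < M)%N -> nonnull K S ->
  exists S1 : {set 'I_M}, nonnull K S1 && (S1 != S).
Proof.
move=> hK hKM hS; have [_ /set0Pn[j jS]] := nonnull_setC hKM hS.
exists [set j]%SET; apply/andP; split; last first.
  by apply: contraTneq jS => <-; rewrite !inE eqxx.
rewrite /nonnull /hypothesis cards1 -card_gt0 cards1 andbT; lia.
Qed.

Lemma split_div_law_gt0 K mu pi S S' : (2 * K < M)%N -> pmf mu -> pmf pi ->
  mu <> pi -> nonnull K S -> nonnull K S' -> S' != S ->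
  0 < split_div (law mu pi S) S'.
Proof.
move=> hKM hmu hpi neq hS hS' dif.
have [S0 SC0] := nonnull_setC hKM hS; have [S'0 S'C0] := nonnull_setC hKM hS'.
have hl i := @law_pmf mu pi S i hmu hpi.
have ge0 B : B != finset.set0 ->
    0 <= \sum_(i in B) kl (law mu pi S i) (pool (law mu pi S) B).
  move=> B0; rewrite sumr_ge0// => i iB; apply: kl_ge0 => //; first exact: pool_pmf.
  exact: pool_dominated.
have [cS _] := andP hS; have [cS' _] := andP hS'.
have [hc1 hc2] := card_setC_gt0 hKM cS cS'.
rewrite /split_div; have [sub|nsub] := boolP (S \subset S').
  rewrite ltr_wpDr ?ge0//; apply: sum_kl_law_gt0 => //.
    by rewrite (finset.setIidPl sub) card_gt0.
  rewrite card_gt0; apply: contra dif => /eqP/eqP; rewrite finset.setD_eq0 => sub'.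
  by rewrite finset.eqEsubset sub sub'.
rewrite ltr_wpDl ?ge0//; apply: sum_kl_law_gt0 => //.
  by rewrite -finset.setDE card_gt0 finset.setD_eq0.
by rewrite finset.setDE finset.setIC (leq_trans hc2 hc1).
Qed.

End two_group_divergence.

Section exponents.
Context {R : realType} {M : nat} {A : finType}.
Implicit Types (mu pi : A -> R) (S : {set 'I_M}).

Lemma alpha_bar_term mu pi S S' : pmf mu -> pmf pi ->
  S' != finset.set0 -> ~: S' != finset.set0 ->
  let m1 := mixture #|S :&: S'| #|S' :\: S| #|S'| mu pi in
  let m2 := mixture #|S :\: S'| #|~: S :&: ~: S'| (M - #|S'|) mu pi in
  (#|S :&: S'|%:R%:E * rel_entropy mu m1 +
     #|S :\: S'|%:R%:E * rel_entropy mu m2 +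
     #|S' :\: S|%:R%:E * rel_entropy pi m1 +
     #|~: S :&: ~: S'|%:R%:E * rel_entropy pi m2)%E =
  (split_div (law mu pi S) S')%:E.
Proof.
move=> hmu hpi S'0 S'C0 m1 m2; have hl i := @law_pmf _ _ _ mu pi S i hmu hpi.
have s1 : S :&: ~: S' = S :\: S' by rewrite finset.setDE.
have s2 : ~: S' :\: S = ~: S :&: ~: S' by rewrite finset.setDE finset.setIC.
have c : #|~: S'| = (M - #|S'|)%N by rewrite cardsCs finset.setCK card_ord.
have e1 : pool (law mu pi S) S' = m1 by rewrite pool_law.
have e2 : pool (law mu pi S) (~: S') = m2.
  by rewrite pool_law s1 s2 c.
have hm1 : pmf m1 by rewrite -e1; exact: pool_pmf.
have hm2 : pmf m2 by rewrite -e2; exact: pool_pmf.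
have term (k : nat) p (B : {set 'I_M}) : (0 < k -> exists2 i, i \in B & law mu pi S i = p)%N ->
    pmf p -> pmf (pool (law mu pi S) B) ->
    (k%:R%:E * rel_entropy p (pool (law mu pi S) B) =
     (k%:R * kl p (pool (law mu pi S) B))%:E)%E.
  case: k => [|k] h hp hB; first by rewrite mul0e mul0r.
  have [i iB <-] := h isT; rewrite rel_entropyE//; [by case: (hl i)|by case: hB|].
  exact: pool_dominated.
have inS (B : {set 'I_M}) : (0 < #|S :&: B| -> exists2 i, i \in B & law mu pi S i = mu)%N.
  rewrite card_gt0 => /set0Pn[i]; rewrite inE => /andP[iS iB].
  by exists i => //; rewrite /law iS.
have ninS (B : {set 'I_M}) : (0 < #|B :\: S| -> exists2 i, i \in B & law mu pi S i = pi)%N.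
  rewrite card_gt0 => /set0Pn[i]; rewrite inE => /andP[/negbTE iS iB].
  by exists i => //; rewrite /law iS.
rewrite -s1 -s2 -e1 -e2 !term ?e1 ?e2//; try by [exact: inS|exact: ninS].
rewrite -!EFinD; congr EFin.
rewrite /split_div (sum_law (fun f => kl f _)) (sum_law (fun f => kl f _)) e1 e2.
by ring.
Qed.

(** The minimum is over a nonempty set: the singleton of a sequence outside
    [S] is a candidate. *)
Lemma alpha_bar_attained K mu pi S : (2 < K)%N -> (2 * K < M)%N ->
  pmf mu -> pmf pi -> mu <> pi -> nonnull K S ->
  exists a : R, [/\ alpha_bar K mu pi S = a%:E, 0 < a,
    forall S', nonnull K S' -> S' != S -> a <= split_div (law mu pi S) S' &
    exists S', [/\ nonnull K S', S' != S & a = split_div (law mu pi S) S'] ].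
Proof.
move=> hK hKM hmu hpi neq hS.
have aE : alpha_bar K mu pi S =
    \big[mine/+oo%E]_(S' | nonnull K S' && (S' != S)) (split_div (law mu pi S) S')%:E.
  apply: eq_bigr => S' /andP[hS' _]; have [S'0 S'C0] := nonnull_setC hKM hS'.
  exact: alpha_bar_term.
have [S1 hS1] := exists_other hK hKM hS.
have [||S2 hS2 eS2] := @eq_bigmin _ _ _ +oo%E S1 (fun S' => nonnull K S' && (S' != S))
  (fun S' => (split_div (law mu pi S) S')%:E) => //.
  by move=> i _; rewrite leey.
have /andP[n2 d2] := hS2.
exists (split_div (law mu pi S) S2); split.
- by rewrite aE eS2.
- exact: (split_div_law_gt0 hKM).
- move=> S' n' d'; rewrite -lee_fin -eS2.
  by apply: (@bigmin_le_cond _ _ _ _ S' (fun S' => nonnull K S' && (S' != S))); rewrite n'.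
- by exists S2.
Qed.

End exponents.

(** * The exponents [eta] and [eta_bar] *)

Section eta_exponents.
Context {R : realType} {M : nat} {A : finType}.
Variables (mu pi : A -> R).
Hypotheses (hmu : pmf mu) (hpi : pmf pi).
Hypotheses (fmu : full_support mu) (fpi : full_support pi) (neq : mu <> pi).

(** The common form of the exponents [eta] and [eta_bar]. *)
Definition eta_inf (a b : nat) : \bar R :=
  ereal_inf [set (a%:R%:E * rel_entropy mu p + b%:R%:E * rel_entropy pi p)%E
            | p in pmf].

Lemma eta_barE K (S : {set 'I_M}) : eta_bar K mu pi S = eta_inf 1 (M - K - #|S|).
Proof.
by rewrite /eta_inf; under eq_imagel do rewrite mul1e.
Qed.

Lemma etaE (S : {set 'I_M}) : eta mu pi S = eta_inf #|S| 1.
Proof. by rewrite /eta_inf; under eq_imagel do rewrite mul1e. Qed.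

Lemma eta_inf_gt0 a b : (0 < a)%N -> (0 < b)%N ->
  exists2 e : R, eta_inf a b = e%:E & 0 < e.
Proof.
move=> a0 b0; set h := hellinger mu pi / 2.
have h0 : 0 < h by rewrite divr_gt0// hellinger_gt0.
have lo : (h%:E <= eta_inf a b)%E.
  apply/ereal_infP => _ [p hp <-].
  have scale (c : nat) (x : \bar R) : (0 < c)%N -> (0 <= x)%E -> (x <= c%:R%:E * x)%E.
    by move=> c0 x0; rewrite lee_pemull// lee_fin ler1n.
  apply: (@le_trans _ _ (rel_entropy mu p + rel_entropy pi p)%E); last first.
    by rewrite leeD// scale// rel_entropy_ge0.
  apply: (@le_trans _ _ ((hellinger mu p)%:E + (hellinger pi p)%:E)%E); last first.
    by rewrite leeD// rel_entropy_ge.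
  by rewrite -EFinD lee_fin /h ler_pdivrMr// mulrC hellinger_triangle.
have up : (eta_inf a b < +oo)%E.
  have dm (p q : A -> R) : full_support q -> dominated p q.
    by move=> fq x qx; have := fq x; rewrite qx ltxx.
  have pos (p : A -> R) : pmf p -> forall x, 0 <= p x by case.
  apply: (@le_lt_trans _ _ (a%:R * kl mu mu + b%:R * kl pi mu)%:E); last by rewrite ltry.
  apply: ge_ereal_inf; eexists; first by exists mu.
  by rewrite !rel_entropyE//; try by [apply: pos|apply: dm].
move: lo up; case: (eta_inf a b) => [e| |]//=; rewrite lee_fin => he _.
by exists e => //; exact: lt_le_trans he.
Qed.

(** A group with at least [a] outliers and [b] typical sequences: its own
    average is one of the distributions in the infimum defining [eta_inf]. *)
Lemma eta_inf_le_group a b (S B : {set 'I_M}) : B != finset.set0 ->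
  (a <= #|S :&: B|)%N -> (b <= #|B :\: S|)%N ->
  (eta_inf a b <= (\sum_(i in B) kl (law mu pi S i) (pool (law mu pi S) B))%:E)%E.
Proof.
move=> B0 ha hb; set p := pool _ _.
have hp : pmf p by apply: pool_pmf => // i; exact: law_pmf.
have fp : full_support p.
  move=> x; rewrite divr_gt0 ?card_gt0R//.
  have /set0Pn[j jB] := B0; rewrite (bigD1 j)//= ltr_wpDr//.
    by rewrite sumr_ge0// => i _; rewrite /law; case: ifP => _; apply: ltW.
  by rewrite /law; case: ifP.
have dp (q : A -> R) : dominated q p by move=> x px; have := fp x; rewrite px ltxx.
have kE (q : A -> R) : pmf q -> rel_entropy q p = (kl q p)%:E.
  by move=> [q0 _]; rewrite rel_entropyE//; case: hp.
apply: (@le_trans _ _ (a%:R%:E * rel_entropy mu p + b%:R%:E * rel_entropy pi p)%E).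
  by apply: ge_ereal_inf; eexists; first by exists p.
rewrite !kE// -!EFinM -EFinD lee_fin (sum_law (fun f => kl f p)).
by rewrite lerD// ler_wpM2r ?kl_ge0// ler_nat.
Qed.

Lemma eta_le_split_div K (S S' : {set 'I_M}) : (2 * K < M)%N ->
  nonnull K S -> nonnull K S' -> S' != S ->
  ((if #|S| == K then eta_bar K mu pi S
    else Order.min (eta_bar K mu pi S) (eta mu pi S))
   <= (split_div (law mu pi S) S')%:E)%E.
Proof.
move=> hKM hS hS' dif.
have [S0 SC0] := nonnull_setC hKM hS; have [S'0 S'C0] := nonnull_setC hKM hS'.
have ge0 B : B != finset.set0 ->
    0 <= \sum_(i in B) kl (law mu pi S i) (pool (law mu pi S) B).
  move=> B0; have hl i := @law_pmf _ _ _ mu pi S i hmu hpi.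
  rewrite sumr_ge0// => i iB; apply: kl_ge0 => //; first exact: pool_pmf.
  exact: pool_dominated.
have [cS _] := andP hS; have [cS' _] := andP hS'.
have [hc1 hc2] := card_setC_gt0 hKM cS cS'.
have [sub|nsub] := boolP (S \subset S').
  have dpos : (0 < #|S' :\: S|)%N.
    rewrite card_gt0; apply: contra dif => /eqP/eqP; rewrite finset.setD_eq0 => sub'.
    by rewrite finset.eqEsubset sub sub'.
  have -> : (#|S| == K) = false.
    apply/negbTE; rewrite neq_ltn; apply/orP; left; apply: leq_trans cS'.
    by rewrite -(cardsID S S') (finset.setIidPr sub) -addn1 leq_add2l.
  rewrite ge_min; apply/orP; right; rewrite etaE.
  apply: (@le_trans _ _ (\sum_(i in S') kl (law mu pi S i) (pool (law mu pi S) S'))%:E).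
    by apply: eta_inf_le_group => //; rewrite (finset.setIidPl sub).
  by rewrite lee_fin lerDl ge0.
have le_bar : (eta_bar K mu pi S <= (split_div (law mu pi S) S')%:E)%E.
  rewrite eta_barE; apply: (@le_trans _ _
    (\sum_(i in ~: S') kl (law mu pi S i) (pool (law mu pi S) (~: S')))%:E).
    apply: eta_inf_le_group => //.
      by rewrite -finset.setDE card_gt0 finset.setD_eq0.
    by rewrite finset.setDE finset.setIC.
  by rewrite lee_fin lerDr ge0.
by case: ifP => // _; rewrite ge_min le_bar.
Qed.

End eta_exponents.

(** * The method of types *)

Section method_of_types.
Context {R : realType} {M : nat} {A : finType}.
Implicit Types (q : 'I_M -> A -> R).

(** Probability of the observations [y] when sequence [i] is i.i.d. with
    distribution [q i]. *)
Definition prod_law q n (y : obs M A n) : R := \prod_(k < n) \prod_i q i (y k i).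

Lemma joint_pmfE mu pi S n (y : obs M A n) :
  joint_pmf mu pi S y = prod_law (law mu pi S) y.
Proof.
apply: eq_bigr => k _; rewrite [RHS](bigID (mem S))/=; congr (_ * _).
  by apply: eq_bigr => i iS; rewrite /law iS.
by apply: eq_bigr => i /negbTE iS; rewrite /law iS.
Qed.

Lemma prod_law_ge0 q n (y : obs M A n) : (forall i a, 0 <= q i a) -> 0 <= prod_law q y.
Proof. by move=> q0; apply: prodr_ge0 => k _; apply: prodr_ge0. Qed.

Lemma sum_prod_law q n : (forall i, pmf (q i)) -> \sum_(y : obs M A n) prod_law q y = 1.
Proof.
move=> hq.
rewrite -(bigA_distr_bigA (fun (k : 'I_n) (z : {ffun 'I_M -> A}) => \prod_i q i (z i)))/=.
apply: big1 => k _; rewrite -(bigA_distr_bigA q).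
by apply: big1 => i _; case: (hq i).
Qed.

Lemma empirical_count n (y : obs M A n) i (g : A -> R) : (0 < n)%N ->
  \sum_(k < n) g (y k i) = n%:R * \sum_a empirical R y i a * g a.
Proof.
move=> n0; rewrite (partition_big (fun k => y k i) xpredT)//= mulr_sumr.
apply: eq_bigr => a _; rewrite (eq_bigr (fun=> g a)) => [|k /eqP -> //].
rewrite /empirical mulrA mulrCA divff ?pnatr_eq0 -?lt0n// mulr1 mulr_natl.
by rewrite sumr_const; congr (_ *+ _); apply: eq_card => k; rewrite !inE.
Qed.

Lemma empirical_pmf n (y : obs M A n) i : (0 < n)%N -> pmf (empirical R y i).
Proof.
move=> n0; split=> [a|]; first by rewrite divr_ge0.
have := empirical_count y i (fun=> 1) n0; rewrite sumr_const card_ord.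
under [in X in _ = X -> _]eq_bigr do rewrite mulr1.
move=> /esym/(canRL (mulKf _)) ->; last by rewrite pnatr_eq0 -lt0n.
by rewrite mulVf// pnatr_eq0 -lt0n.
Qed.

Lemma empirical_neq0 n (y : obs M A n) i a : empirical R y i a != 0 ->
  exists k, y k i = a.
Proof.
rewrite mulf_eq0 negb_or pnatr_eq0 cards_eq0 => /andP[/set0Pn[k]].
by rewrite inE => /eqP ya _; exists k.
Qed.

Lemma empirical_gt0 n (y : obs M A n) i k : 0 < empirical R y i (y k i).
Proof.
have n0 : (0 < n)%N by case: n y k => [|n] y k //; case: k.
rewrite divr_gt0 ?ltr0n// card_gt0; apply/set0Pn; exists k.
by rewrite inE.
Qed.

(** An outcome is less likely under [q] than under its own empirical
    distributions, by a factor exponential in the divergence between them. *)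
Lemma prod_law_le q n (y : obs M A n) (L : R) : (0 < n)%N ->
  (forall i a, 0 <= q i a) ->
  ((forall i, dominated (empirical R y i) (q i)) ->
    L <= n%:R * \sum_i kl (empirical R y i) (q i)) ->
  prod_law q y <= expR (- L) * prod_law (empirical R y) y.
Proof.
move=> n0 q0 hL.
have e0 : forall i a, 0 <= empirical R y i a by move=> i a; rewrite divr_ge0.
have [->|qN0] := eqVneq (prod_law q y) 0.
  by rewrite mulr_ge0 ?expR_ge0// prod_law_ge0.
have qp k i : 0 < q i (y k i).
  rewrite lt_def q0 andbT; apply: contraNN qN0 => /eqP qe.
  by rewrite /prod_law (bigD1 k)//= (bigD1 i)//= qe !mul0r.
have lnE (r : 'I_M -> A -> R) : (forall k i, 0 < r i (y k i)) ->
    prod_law r y = expR (n%:R * \sum_i \sum_a empirical R y i a * ln (r i a)).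
  move=> rp; rewrite mulr_sumr; under eq_bigr do rewrite -empirical_count//.
  rewrite exchange_big/= expR_sum; apply: eq_bigr => k _.
  by rewrite expR_sum; apply: eq_bigr => i _; rewrite lnK// posrE.
rewrite !lnE//; last by move=> k i; exact: empirical_gt0.
rewrite -expRD ler_expR; set u := leLHS; set v := (X in _ <= _ + X).
suff : L <= v - u by lra.
apply: (le_trans (hL _)).
  move=> i a qa; apply/eqP/negPn/negP => /empirical_neq0[k yk].
  by have := qp k i; rewrite yk qa ltxx.
rewrite -mulrBr ler_wpM2l// -sumrB ler_sum// => i _.
by rewrite /kl -sumrB ler_sum// => a _; rewrite mulrBr.
Qed.

(** The number of joint types is polynomial in [n]. *)
Lemma sum_prod_law_empirical n : (0 < n)%N ->
  \sum_(y : obs M A n) prod_law (empirical R y) y <= n.+1%:R ^+ (M * #|A|).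
Proof.
move=> n0.
pose tau_law (t : {ffun 'I_M -> {ffun A -> 'I_n.+1}}) i a : R := (t i a)%:R / n%:R.
pose valid (t : {ffun 'I_M -> {ffun A -> 'I_n.+1}}) := [forall i, \sum_a t i a == n]%N.
have n1 : n%:R != 0 :> R by rewrite pnatr_eq0 -lt0n.
have tau_pmf t : valid t -> forall i, pmf (tau_law t i).
  move=> /forallP ht i; split=> [a|]; first by rewrite divr_ge0.
  by rewrite -mulr_suml -natr_sum (eqP (ht i)) divff.
pose type (y : obs M A n) : {ffun 'I_M -> {ffun A -> 'I_n.+1}} :=
  [ffun i => [ffun a => inord #|[set k | y k i == a]%SET|]].
have typeE y i a : type y i a = #|[set k | y k i == a]%SET| :> nat.
  by rewrite !ffunE inordK// ltnS (leq_trans (max_card _))// card_ord.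
have type_law y : tau_law (type y) = empirical R y.
  by apply/funext => i; apply/funext => a; rewrite /tau_law typeE.
have type_valid y : valid (type y).
  apply/forallP => i; rewrite -(@eqr_nat R) natr_sum.
  have [_ h] := empirical_pmf y i n0; apply/eqP.
  transitivity (n%:R * \sum_a empirical R y i a); last by rewrite h mulr1.
  rewrite mulr_sumr; apply: eq_bigr => a _.
  by rewrite typeE /empirical mulrCA divff// mulr1.
(* Each term is bounded by the sum over all joint types [t], and for fixed [t]
   the probabilities of all outcomes add up to 1. *)
apply: (@le_trans _ _ (\sum_(y : obs M A n) \sum_(t | valid t) prod_law (tau_law t) y)).
  apply: ler_sum => y _; rewrite (bigD1 (type y))//= type_law lerDl sumr_ge0//.
  by move=> t _; apply: prod_law_ge0 => i a; rewrite divr_ge0.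
rewrite exchange_big/= (eq_bigr (fun=> 1)) => [|t ht]; last first.
  by apply: sum_prod_law; exact: tau_pmf.
rewrite sumr_const -natrX ler_nat (leq_trans (max_card _))//.
by rewrite !card_ffun !card_ord mulnC expnM.
Qed.

(** Large deviations by the method of types. *)
Lemma prob_divergence_ge q n (E : pred (obs M A n)) (L : R) : (0 < n)%N ->
  (forall i a, 0 <= q i a) ->
  (forall y, E y -> (forall i, dominated (empirical R y i) (q i)) ->
    L <= n%:R * \sum_i kl (empirical R y i) (q i)) ->
  \sum_(y | E y) prod_law q y <= n.+1%:R ^+ (M * #|A|) * expR (- L).
Proof.
move=> n0 q0 hL.
apply: (@le_trans _ _ (\sum_(y : obs M A n) expR (- L) * prod_law (empirical R y) y)).
  rewrite [leRHS](bigID E)/= ler_wpDr//.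
    rewrite sumr_ge0// => y _; rewrite mulr_ge0 ?expR_ge0//.
    by apply: prod_law_ge0 => i a; rewrite divr_ge0.
  by apply: ler_sum => y Ey; apply: prod_law_le => //; exact: hL.
by rewrite -mulr_sumr mulrC ler_wpM2r ?expR_ge0// sum_prod_law_empirical.
Qed.

End method_of_types.

(** * Growth estimates *)

Section growth.
Context {R : realType}.

(** Logarithms are dominated by linear functions of arbitrarily small slope. *)
Lemma ln_le_linear (D : nat) (b : R) : 0 < b ->
  exists2 C : R, 0 <= C & forall n : nat, D%:R * ln n.+1%:R <= C + b * n%:R.
Proof.
move=> b0; case: D => [|D].
  by exists 0 => // n; rewrite mul0r add0r mulr_ge0// ltW.
set k : R := D.+1%:R / b; have k0 : 0 < k by rewrite divr_gt0.
exists (`|D.+1%:R * ln k| + b); first by rewrite addr_ge0// ltW.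
move=> n; have hl : ln (n.+1%:R / k) <= n.+1%:R / k - 1.
  have := @le_ln1Dx R (n.+1%:R / k - 1); rewrite addrCA subrr addr0; apply.
  by rewrite ltrBrDr addrC subrr divr_gt0.
rewrite ln_div ?posrE// in hl.
have hk : D.+1%:R * (n.+1%:R / k) = b * n%:R + b.
  by rewrite /k invf_div mulrCA (mulrC _ (b / _)) divfK ?pnatr_eq0// -natr1; ring.
have h2 : D.+1%:R * ln n.+1%:R <= D.+1%:R * (n.+1%:R / k + ln k).
  by rewrite ler_wpM2l//; lra.
rewrite (le_trans h2)// mulrDr hk; have := ler_norm (D.+1%:R * ln k); lra.
Qed.

Lemma pow_expR_le (D : nat) (b : R) : 0 < b ->
  exists2 C : R, 0 < C & forall n : nat,
    n.+1%:R ^+ D * expR (- (2 * b * n%:R)) <= C * expR (- b) ^+ n.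
Proof.
move=> b0; have [C C0 hC] := ln_le_linear D b0.
exists (expR C) => [|n]; first exact: expR_gt0.
have -> : n.+1%:R ^+ D = expR (D%:R * ln n.+1%:R) :> R.
  by rewrite expRM_natl lnK// posrE.
rewrite -expRM_natl -!expRD ler_expR; have := hC n; lra.
Qed.

Lemma geometric_sum_le (r : R) n : 0 <= r < 1 -> \sum_(k < n) r ^+ k <= (1 - r)^-1.
Proof.
move=> /andP[r0 r1]; rewrite -[leRHS]mul1r ler_pdivlMr ?subr_gt0//.
have := subrX1 r n; set s := \sum_(_ < _) _ => e.
have : 0 <= r ^+ n by rewrite exprn_ge0.
lra.
Qed.

Lemma sum_inv_sqr_le n : \sum_(k < n) (k.+1%:R ^+ 2)^-1 <= 2 :> R.
Proof.
suff h m : \sum_(k < m.+1) (k.+1%:R ^+ 2)^-1 <= 2 - m.+1%:R^-1 :> R.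
  case: n => [|n]; first by rewrite big_ord0.
  by rewrite (le_trans (h n))// gerBl invr_ge0.
elim: m => [|m IH]; first by rewrite big_ord1 expr1n invr1; lra.
rewrite big_ord_recr/=; apply: (le_trans (lerD IH (lexx _))).
set x : R := m.+1%:R; have x0 : 0 < x by rewrite ltr0n.
have -> : m.+2%:R = x + 1 :> R by rewrite -natr1.
suff : ((x + 1) ^+ 2)^-1 <= x^-1 - (x + 1)^-1.
  set u := x^-1; set v := (x + 1)^-1; set w := (_ ^+ 2)^-1 => h; lra.
have -> : x^-1 - (x + 1)^-1 = (x * (x + 1))^-1.
  by field; rewrite !gt_eqF//; lra.
rewrite lef_pV2 ?posrE ?mulr_gt0 ?exprn_gt0 ?addr_gt0// expr2 ler_pM2r ?addr_gt0//; lra.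
Qed.

End growth.

(** * Trajectories of the test *)

Section test_trajectory.
Context {R : realType} {M : nat} {A : finType} (K : nat).
Hypotheses (hK : (2 < K)%N) (hKM : (2 * K < M)%N).
Variables (mu pi : A -> R) (hmu : pmf mu) (hpi : pmf pi).
Implicit Types (S : {set 'I_M}) (Sh : ml_rule R M A K).

Lemma G_split_div n (y : obs M A n) S : (0 < n)%N -> nonnull K S ->
  G R y S = (split_div (empirical R y) S)%:E.
Proof.
move=> n0 /(nonnull_setC hKM)[S0 SC0].
have he i := @empirical_pmf R _ _ _ y i n0.
have rE B : B != finset.set0 -> forall i, i \in B ->
    rel_entropy (empirical R y i) (pooled R y B) =
    (kl (empirical R y i) (pool (empirical R y) B))%:E.
  move=> B0 i iB; have [p0 _] := he i; have [q0 _] := pool_pmf B0 he.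
  by rewrite rel_entropyE//; exact: pool_dominated.
rewrite /G EFinD -!sumEFin; congr (_ + _)%E;
  by apply: eq_bigr => i iS; rewrite rE.
Qed.

(** The threshold that [n] times the gap has to exceed for the test to stop. *)
Definition threshold (T : R) n : R := ln T + (M.+1 * #|A|)%:R * ln n.+1%:R.

Lemma crossesP Sh T n (y : obs M A n) : (0 < n)%N ->
  crosses Sh T y <-> forall S, nonnull K S -> S != Sh n y ->
    threshold T n <
      n%:R * (split_div (empirical R y) S - split_div (empirical R y) (Sh n y)).
Proof.
move=> n0; rewrite /crosses n0/=.
have E S : nonnull K S -> (n%:R%:E * (G R y S - G R y (Sh n y)))%E =
    (n%:R * (split_div (empirical R y) S - split_div (empirical R y) (Sh n y)))%:E.
  by move=> hS; rewrite !G_split_div//; exact: S_hat_nonnull.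
split=> [/bigmin_gtP[_ h] S hS dS|h].
  by rewrite -lte_fin -E//; apply: h; rewrite hS.
apply/bigmin_gtP; split; first by rewrite ltry.
by move=> S /andP[hS dS]; rewrite E// lte_fin; exact: h.
Qed.

(** Stopping on a wrong set requires that the empirical distributions diverge
    from the true ones by at least the threshold. *)
Lemma crosses_wrong Sh T n (y : obs M A n) S : hypothesis K S ->
  crosses Sh T y -> Sh n y != S ->
  (forall i, dominated (empirical R y i) (law mu pi S i)) ->
  threshold T n <= n%:R * \sum_i kl (empirical R y i) (law mu pi S i).
Proof.
move=> hS cr neqS hd; have n0 : (0 < n)%N by case/andP: cr.
have he i := @empirical_pmf R _ _ _ y i n0.
have hSh := S_hat_nonnull Sh y n0.
have [Sh0 ShC0] := nonnull_setC hKM hSh.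
(* [S] itself serves when it is nonempty. Under the null hypothesis all
   sequences have distribution [pi], and any admissible set serves. *)
have [S' [hS' dS' lS']] : exists S', [/\ nonnull K S', S' != Sh n y &
    split_div (empirical R y) S' <= \sum_i kl (empirical R y i) (law mu pi S i)].
  have [S0|S0] := eqVneq S finset.set0.
    have [S' /andP[h1 h2]] := exists_other hK hKM hSh; exists S'; split=> //.
    by apply: (split_div_le (r1 := pi) (r2 := pi)) => // i _; rewrite /law S0 inE.
  exists S; rewrite /nonnull hS S0 eq_sym; split=> //.
  apply: (split_div_le (r1 := mu) (r2 := pi)) => // i; first by rewrite /law => ->.
  by rewrite /law => /negbTE ->.
have /(crossesP Sh T y n0)/(_ S' hS' dS') := cr.
move/ltW/le_trans; apply; rewrite ler_wpM2l//.
rewrite (le_trans _ lS')// gerBl; exact: split_div_ge0.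
Qed.

(** Some empirical frequency deviates by more than [d] from its expectation. *)
Definition far (d : R) (q : 'I_M -> A -> R) n (y : obs M A n) : bool :=
  [exists i, exists a, d < `|empirical R y i a - q i a|].

Lemma prob_far d q n : (0 < n)%N -> 0 <= d -> (forall i, pmf (q i)) ->
  \sum_(y : obs M A n | far d q y) prod_law q y <=
  n.+1%:R ^+ (M * #|A|) * expR (- (n%:R * (d ^+ 2 / 4))).
Proof.
move=> n0 d0 hq; apply: prob_divergence_ge => // [i a|y]; first by case: (hq i).
move=> /existsP[i /existsP[a da]] hd; rewrite ler_wpM2l//.
have he j := @empirical_pmf R _ _ _ y j n0.
apply: (@le_trans _ _ (kl (empirical R y i) (q i))); last first.
  by rewrite (bigD1 i)//= lerDl sumr_ge0// => j _; exact: kl_ge0.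
apply: le_trans (kl_ge_hellinger (he i) (hq i) (hd i)).
rewrite ler_pdivrMr// mulrC (le_trans _ (sqr_dist_le_hellinger a (he i) (hq i)))//.
by rewrite -[leRHS]real_normK ?num_real// lerXn2r ?nnegrE// ltW.
Qed.

(** When all empirical frequencies are close to their expectations, the test
    stops as soon as [n] times the smallest divergence gap, up to the
    modulus of continuity, exceeds the threshold. *)
Lemma near_crosses Sh T n (y : obs M A n) S d a : (0 < n)%N ->
  nonnull K S -> ~~ far d (law mu pi S) y ->
  (forall S', nonnull K S' -> S' != S -> a <= split_div (law mu pi S) S') ->
  8 * M%:R * #|A|%:R * Num.sqrt d < a ->
  threshold T n < n%:R * (a - 8 * M%:R * #|A|%:R * Num.sqrt d) ->
  crosses Sh T y.
Proof.
move=> n0 hS nfar ha ea hth.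
have he i := @empirical_pmf R _ _ _ y i n0.
have hl i := @law_pmf R M A mu pi S i hmu hpi.
have close i b : `|empirical R y i b - law mu pi S i b| <= d.
  move: nfar; rewrite negb_exists => /forallP/(_ i).
  by rewrite negb_exists => /forallP/(_ b); rewrite -leNgt.
have mod S' : nonnull K S' -> `|split_div (empirical R y) S' -
    split_div (law mu pi S) S'| <= 4 * M%:R * #|A|%:R * Num.sqrt d.
  by move=> /(nonnull_setC hKM)[S0 SC0]; exact: split_div_modulus.
move: ea hth mod; set s := Num.sqrt d.
rewrite (_ : 8 * M%:R * #|A|%:R * s = 2 * (4 * M%:R * #|A|%:R * s)); last by ring.
set e := 4 * _ * _ * s => ea hth mod.
have self0 : split_div (law mu pi S) S = 0.
  by have [S0 SC0] := nonnull_setC hKM hS; exact: split_div_law_self.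
have gap S' : nonnull K S' -> S' != S ->
    a - 2 * e <= split_div (empirical R y) S' - split_div (empirical R y) S.
  move=> hS' dS'; have := ha _ hS' dS'; have := mod _ hS'; have := mod _ hS.
  by rewrite self0 !ler_norml => /andP[? ?] /andP[? ?] ?; lra.
have ShS : Sh n y = S.
  apply/eqP/negPn/negP => dif; have hSh := S_hat_nonnull Sh y n0.
  have := S_hat_min Sh y n0 hS; rewrite !G_split_div// lee_fin.
  have := gap _ hSh dif; lra.
apply/(crossesP Sh T y n0) => S' hS'; rewrite ShS => dS'.
by rewrite (lt_le_trans hth)// ler_wpM2l// gap.
Qed.

(** Deviations that keep the gap in [near_crosses] above [a - e]. *)
Lemma exists_deviation (e : R) : 0 < e ->
  exists2 d : R, 0 < d & 8 * M%:R * #|A|%:R * Num.sqrt d <= e.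
Proof.
move=> e0; set c : R := 8 * M%:R * #|A|%:R.
have c0 : 0 <= c by rewrite !mulr_ge0.
exists ((e / (c + 1)) ^+ 2); first by rewrite exprn_gt0// divr_gt0//; lra.
rewrite sqrtr_sqr ger0_norm; last by rewrite divr_ge0//; lra.
rewrite mulrA ler_pdivrMr; last lra.
by rewrite mulrC ler_pM2l//; lra.
Qed.

Lemma N_star_le Sh T F x : (N_star Sh T F x <= Num.truncn F)%N.
Proof. by rewrite /N_star; case: N_tilde => // n; rewrite geq_minr. Qed.

Lemma N_star_not_crosses Sh T F x n : (n < N_star Sh T F x)%N ->
  ~~ crosses Sh T (prefix n x).
Proof.
rewrite /N_star; case E: (N_tilde Sh T x) => [m|] h.
  have /first_time_some[_ hm] := E; apply: hm; exact: leq_trans h (geq_minl _ _).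
by move/first_time_none: E; apply.
Qed.

(** A wrong decision is either a wrong stop or, for a nonempty [S], a stop that
    comes too late. *)
Lemma delta_star_wrong Sh T F x S : delta_star Sh T F x != S ->
  (exists n, [/\ (n <= Num.truncn F)%N, crosses Sh T (prefix n x) &
                 Sh n (prefix n x) != S]) \/
  (S != finset.set0 /\ forall n, (n <= Num.truncn F)%N -> ~~ crosses Sh T (prefix n x)).
Proof.
rewrite /delta_star /N_star; case E: (N_tilde Sh T x) => [m|]; last first.
  by move=> S0; right; rewrite eq_sym; split=> // n _; move/first_time_none: E; apply.
have /first_time_some[cm hm] := E.
rewrite truncn_geN ?(N_tilde_gt0 E)//; case: (leqP m (Num.truncn F)) => [mF|Fm] dS.
  by left; exists m; split=> //; move: dS; rewrite (minn_idPl mF).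
right; rewrite eq_sym; split=> // n nF; apply: hm; exact: leq_ltn_trans nF Fm.
Qed.

End test_trajectory.

(** * Events determined by finitely many observations *)

Section prefix_events.
Context {R : realType} {M : nat} {A : finType} (K : nat) (mu pi : A -> R).
Context (d : measure_display) (Omega : measurableType d).
Variables (P : {set 'I_M} -> probability Omega R) (Y : Omega -> path M A).
Hypothesis HY : outlier_model K mu pi P Y.

Lemma measurable_cylinder n (y : obs M A n) :
  measurable [set w | prefix n (Y w) = y].
Proof.
rewrite (_ : [set w | _] = \bigcap_(ki in [set: 'I_n * 'I_M])
    [set w | Y w ki.1 ki.2 = y ki.1 ki.2]).
  by apply: fin_bigcap_measurable => // ki _; exact: (model_measurable HY).
apply/seteqP; split=> w /= h.
  move=> [k i] _ /=; have := congr1 (fun z : obs M A n => z k i) h.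
  by rewrite /prefix !ffunE.
by apply/ffunP => k; apply/ffunP => i; rewrite !ffunE; exact: (h (k, i)).
Qed.

Let cylinders n (E : pred (obs M A n)) :
  [set w | E (prefix n (Y w))] =
  \bigcup_(y in [set` E]) [set w | prefix n (Y w) = y].
Proof.
apply/seteqP; split=> w /= h; first by exists (prefix n (Y w)).
by have [y Ey ->] := h.
Qed.

Lemma measurable_prefix n (E : pred (obs M A n)) :
  measurable [set w | E (prefix n (Y w))].
Proof.
rewrite cylinders; apply: fin_bigcup_measurable => // y _.
exact: measurable_cylinder.
Qed.

Lemma prob_prefix S n (E : pred (obs M A n)) : hypothesis K S ->
  P S [set w | E (prefix n (Y w))] =
  (\sum_(y | E y) prod_law (law mu pi S) y)%:E.
Proof.
move=> hS; rewrite cylinders measure_fin_bigcup//.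
- rewrite -(@bigfs _ _ _ _ (index_enum (obs M A n))) ?index_enum_uniq// => [|y _]; last first.
    by rewrite mem_index_enum.
  rewrite -sumEFin; apply: eq_bigr => y _.
  by rewrite -joint_pmfE; exact: (model_law HY).
- by move=> y z _ _ [w [/= <- <-]].
- by move=> y _; exact: measurable_cylinder.
Qed.

(** [g] only depends on the first [n] observations. *)
Definition determined n (T : Type) (g : path M A -> T) : Prop :=
  forall x y, prefix n x = prefix n y -> g x = g y.

Lemma measurable_determined n (Q : path M A -> Prop) : determined n Q ->
  measurable [set w | Q (Y w)].
Proof.
move=> hQ; rewrite (_ : [set w | _] =
    [set w | [pred y | `[< exists x, prefix n x = y /\ Q x >] ] (prefix n (Y w))]).
  exact: measurable_prefix.
apply/seteqP; split=> w /=; first by move=> Qw; apply/asboolP; exists (Y w).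
by move=> /asboolP[x [/hQ <-]].
Qed.

Lemma measurable_fun_determined d' (T : measurableType d') n (g : path M A -> T) :
  determined n g -> measurable_fun setT (fun w => g (Y w)).
Proof.
move=> hg _ U _; rewrite setTI.
by apply: (@measurable_determined n (fun x => U (g x))) => x y /hg ->.
Qed.

End prefix_events.

(** * Probability of error *)

Lemma card_gt1_pmf (R : realType) (A : finType) (mu pi : A -> R) :
  pmf mu -> pmf pi -> mu <> pi -> (1 < #|A|)%N.
Proof.
move=> [_ mu1] [_ pi1] neq; rewrite ltnNge; apply/negP => A1; apply: neq.
apply/funext => a.
have only b : b = a by move/fintype_le1P : A1 => /(_ b a).
have one (p : A -> R) : \sum_x p x = p a.
  by rewrite (bigD1 a)//= big1 ?addr0// => b; rewrite (only b) eqxx.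
by rewrite -one -[RHS]one mu1 pi1.
Qed.

Section performance.
Context {R : realType} {M : nat} {A : finType} (K : nat).
Hypotheses (hK : (2 < K)%N) (hKM : (2 * K < M)%N).
Variables (mu pi : A -> R) (hmu : pmf mu) (hpi : pmf pi) (neq : mu <> pi).
Implicit Types (S : {set 'I_M}) (Sh : ml_rule R M A K).

Lemma N_star_determined Sh T F : determined (Num.truncn F) (N_star Sh T F).
Proof.
move=> x y e; apply/esym/N_star_adapted; apply: prefix_le e; exact: N_star_le.
Qed.

Lemma delta_star_determined Sh T F : determined (Num.truncn F) (delta_star Sh T F).
Proof.
move=> x y e; apply/esym/delta_star_adapted; apply: prefix_le e; exact: N_star_le.
Qed.

Section one_model.
Context (d : measure_display) (Omega : measurableType d).
Variables (P : {set 'I_M} -> probability Omega R) (Y : Omega -> path M A).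
Hypothesis HY : outlier_model K mu pi P Y.

Lemma prob_wrong_stop Sh (T : R) n S : hypothesis K S -> 0 < T ->
  (P S [set w | crosses Sh T (prefix n (Y w)) && (Sh n (prefix n (Y w)) != S)]
   <= (T^-1 * (n.+1%:R ^+ 2)^-1)%:E)%E.
Proof.
move=> hS T0.
rewrite (prob_prefix HY (fun y => crosses Sh T y && (Sh n y != S)))// lee_fin.
have l0 i b : 0 <= law mu pi S i b by case: (@law_pmf R M A mu pi S i hmu hpi).
case: n => [|n].
  by rewrite big1 ?mulr_ge0 ?invr_ge0 ?(ltW T0)// => y /andP[/andP[]].
apply: (le_trans (prob_divergence_ge (L := threshold (M := M) (A := A) T n.+1) _ _ _)) => //.
  by move=> y /andP[cr dif] hd; exact: (crosses_wrong hK hKM hmu hpi hS cr dif hd).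
set m : R := n.+2%:R; have m0 : 0 < m by rewrite ltr0n.
have -> : expR (- threshold (M := M) (A := A) T n.+1) = T^-1 * m ^- (M.+1 * #|A|).
  by rewrite /threshold opprD expRD !expRN lnK ?posrE// expRM_natl lnK ?posrE.
rewrite mulrCA ler_wpM2l ?invr_ge0 ?(ltW T0)// mulSn addnC exprD invfM.
rewrite mulrA divff ?mul1r ?expf_neq0 ?gt_eqF//.
rewrite lef_pV2 ?posrE ?exprn_gt0//; apply: ler_weXn2l; last exact: card_gt1_pmf neq.
by rewrite ler1n.
Qed.

Lemma prob_error_le Sh (T F : R) S : hypothesis K S -> 0 < T ->
  (P S [set w | delta_star Sh T F (Y w) <> S] <=
   (2 / T)%:E + P S [set w | (S != finset.set0) &&
                      ~~ crosses Sh T (prefix (Num.truncn F) (Y w))])%E.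
Proof.
move=> hS T0; set B := Num.truncn F; set late := [set w | _ && _].
pose wrong n := [set w | crosses Sh T (prefix n (Y w)) && (Sh n (prefix n (Y w)) != S)].
pose H k := if (k < B.+1)%N then wrong k else late.
have mwrong n : measurable (wrong n).
  exact: (measurable_prefix HY (fun y => crosses Sh T y && (Sh n y != S))).
have mlate : measurable late.
  exact: (measurable_prefix HY (fun y => (S != finset.set0) && ~~ crosses Sh T y)).
have mdelta : measurable [set w | delta_star Sh T F (Y w) <> S].
  apply: (measurable_determined HY (n := B) (Q := fun x => delta_star Sh T F x <> S)).
  by move=> x y /delta_star_determined ->.
apply: (@le_trans _ _ (\sum_(k < B.+2) P S (H k))%E).
  apply: content_subadditive => //.
    by move=> k _; rewrite /H; case: ifP.
  move=> w /= /eqP/delta_star_wrong[[n [nB cr dif]]|[S0 hn]].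
    rewrite -bigcup_mkord; exists n; first by rewrite /= ltnS leqW.
    by rewrite /H ltnS nB /wrong /= cr dif.
  rewrite -bigcup_mkord; exists B.+1; first exact: ltnSn.
  by rewrite /H ltnn /late /= S0 hn.
rewrite big_ord_recr/= {2}/H ltnn leeD2r//.
apply: (@le_trans _ _ (\sum_(k < B.+1) (T^-1 * (k.+1%:R ^+ 2)^-1)%:E)%E).
  by apply: lee_sum => k _; rewrite /H ltn_ord; exact: prob_wrong_stop.
by rewrite sumEFin lee_fin -mulr_sumr mulrC ler_wpM2r ?invr_ge0 ?(ltW T0)// sum_inv_sqr_le.
Qed.

Lemma prob_not_near S n (dl : R) : hypothesis K S -> (0 < n)%N -> 0 <= dl ->
  (P S [set w | far dl (law mu pi S) (prefix n (Y w))] <=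
   (n.+1%:R ^+ (M * #|A|) * expR (- (n%:R * (dl ^+ 2 / 4))))%:E)%E.
Proof.
move=> hS n0 dl0; rewrite (prob_prefix HY (fun y => far dl (law mu pi S) y))//.
by rewrite lee_fin; apply: prob_far => // i; exact: law_pmf.
Qed.

End one_model.

(** The probability of error is [O(1/T)], with a constant that depends neither
    on the test rule, nor on [f], nor on the probability space. *)
Lemma prob_error_O_inv (c T0 : R) S : 0 < c -> hypothesis K S ->
  exists2 C : R, 0 <= C & forall Sh (f : R -> R), grows_TlogT c T0 f ->
  forall (d : measure_display) (Omega : measurableType d)
    (P : {set 'I_M} -> probability Omega R) (Y : Omega -> path M A),
  outlier_model K mu pi P Y -> forall T, 0 < T ->
  (P S [set w | delta_star Sh T (f T) (Y w) <> S] <= (C / T)%:E)%E.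
Proof.
move=> c0 hS; have [S0|S0] := eqVneq S finset.set0.
  exists 2 => // Sh f _ d Omega P Y HY T Tp.
  apply: (le_trans (prob_error_le HY Sh (f T) hS Tp)).
  rewrite (_ : [set w | _ && _] = set0) ?measure0 ?adde0//.
  by apply/seteqP; split=> w //=; rewrite S0 eqxx.
have nS : nonnull K S by rewrite /nonnull hS.
have [a [_ a0 ha _]] := alpha_bar_attained hK hKM hmu hpi neq nS.
have a2 : 0 < a / 2 by rewrite divr_gt0.
have [dl dl0 hdl] := @exists_deviation R M A _ a2.
have b0 : 0 < dl ^+ 2 / 8 by rewrite divr_gt0// exprn_gt0.
have [C1 C10 hC1] := pow_expR_le (M * #|A|).+1 b0.
have a4 : 0 < a / 4 by rewrite divr_gt0.
have [C2 C20 hC2] := ln_le_linear (M.+1 * #|A|).+1 a4.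
have q0 : 0 <= 4 * C2 / a by rewrite divr_ge0 ?mulr_ge0 ?(ltW a0).
(* For [T] at least [T1] one has [f T >= c * T * ln T >= T], and the last time
   [B] allowed is so large that the linear growth of the statistic beats the
   threshold; for smaller [T] the bound is trivial. *)
set T1 : R := `|T0| + expR c^-1 + 4 * C2 / a + 2.
have T1p : 0 < T1 by rewrite /T1; have := expR_gt0 c^-1; have := normr_ge0 T0; lra.
exists (T1 + 2 + C1); first by lra.
move=> Sh f hf d Omega P Y HY T Tp.
have [TT1|T1T] := ltP T T1.
  apply: (@le_trans _ _ 1%:E).
    apply: probability_le1; apply: (measurable_determined HY (n := Num.truncn (f T))
      (Q := fun x => delta_star Sh T (f T) x <> S)).
    by move=> x y /delta_star_determined ->.
  by rewrite lee_fin ler_pdivlMr// mul1r; lra.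
set B := Num.truncn (f T).
have T0T : T0 <= T.
  by apply: le_trans T1T; rewrite /T1; have := ler_norm T0; have := expR_gt0 c^-1; lra.
have lnT : c^-1 <= ln T.
  rewrite -ler_expR lnK ?posrE//; apply: le_trans T1T.
  by rewrite /T1; have := normr_ge0 T0; lra.
have fT : T <= f T.
  apply: le_trans (hf _ T0T); rewrite mulrCA ler_peMr ?(ltW Tp)//.
  by rewrite -ler_pdivrMl// mulr1.
have TB : T < B.+1%:R by apply: le_lt_trans fT _; exact: truncnS_gt.
have Bbig : 4 * C2 / a + 1 < B%:R.
  rewrite -natr1 in TB; have := le_lt_trans T1T TB.
  by rewrite /T1; have := normr_ge0 T0; have := expR_gt0 c^-1; lra.
have B0 : (0 < B)%N by rewrite -(ltr0n R); lra.
apply: (le_trans (prob_error_le HY Sh (f T) hS Tp)).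
(* The power of [B + 1] is one more than the number of types requires, which
   leaves a factor [B + 1 > T]. *)
have farE : (P S [set w | far dl (law mu pi S) (prefix B (Y w))] <= (C1 / T)%:E)%E.
  apply: (le_trans (prob_not_near HY hS B0 (ltW dl0))); rewrite lee_fin.
  rewrite ler_pdivlMr//.
  apply: (@le_trans _ _ (B.+1%:R ^+ (M * #|A|).+1 * expR (- (2 * (dl ^+ 2 / 8) * B%:R)))).
    rewrite (_ : B%:R * (dl ^+ 2 / 4) = 2 * (dl ^+ 2 / 8) * B%:R); last by field.
    rewrite [_ ^+ (_ * _).+1]exprSr -!mulrA ler_wpM2l ?exprn_ge0//.
    by rewrite mulrC ler_wpM2r ?expR_ge0// ltW.
  apply: (le_trans (hC1 B)); rewrite ler_piMr ?(ltW C10)//.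
  by rewrite exprn_ile1 ?expR_ge0// -[leRHS]expR0 ler_expR oppr_le0 ltW.
apply: (@le_trans _ _ ((2 / T)%:E + (C1 / T)%:E)%E); last first.
  rewrite -EFinD lee_fin -mulrDl ler_wpM2r ?invr_ge0 ?(ltW Tp)//; lra.
rewrite leeD2l//; apply: le_trans farE; apply: le_measure; rewrite ?inE.
- exact: (measurable_prefix HY (fun y => (S != finset.set0) && ~~ crosses Sh T y)).
- exact: (measurable_prefix HY (fun y => far dl (law mu pi S) y)).
move=> w /= /andP[_]; apply: contraNT => nf.
apply: (near_crosses hKM hmu hpi Sh B0 nS nf ha); first by lra.
have lnTB : ln T <= ln B.+1%:R by rewrite ler_ln ?posrE// ltW.
have := hC2 B; rewrite -[(_ * _).+1]addn1 natrD mulrDl mul1r => h.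
have e1 : threshold (M := M) (A := A) T B <= C2 + a / 4 * B%:R by rewrite /threshold; lra.
apply: (le_lt_trans e1).
apply: (@lt_le_trans _ _ (B%:R * (a / 2))); last by rewrite ler_wpM2l//; lra.
have : 4 * C2 < a * B%:R by rewrite -ltr_pdivrMl// mulrC; lra.
lra.
Qed.

End performance.

(** * Expected duration *)

(** If from time [m] to time [N] every step is exceptional, [N] exceeds [m] by
    at most the number of exceptional times. *)
Lemma count_exceptions (m B N : nat) (e : nat -> bool) : (N <= B)%N ->
  (forall n, (m <= n)%N -> (n < N)%N -> e n) -> (N <= m + \sum_(n < B) e n)%N.
Proof.
move=> NB he; have [Nm|mN] := leqP N m; first exact: leq_trans Nm (leq_addr _ _).
rewrite -leq_subLR -(big_mkord xpredT (fun n => e n : nat)).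
rewrite (big_cat_nat (leq0n N) NB)/= (big_cat_nat (leq0n m) (ltnW mN))/=.
have -> : (\sum_(m <= i < N) e i = N - m)%N.
  rewrite -[RHS]muln1 -sum_nat_const_nat; apply: eq_big_nat => i /andP[mi iN].
  by rewrite he.
by rewrite addnAC leq_addl.
Qed.

Section expected_duration.
Context {R : realType} {M : nat} {A : finType} (K : nat).
Hypotheses (hK : (2 < K)%N) (hKM : (2 * K < M)%N).
Variables (mu pi : A -> R) (hmu : pmf mu) (hpi : pmf pi).
Implicit Types (S : {set 'I_M}) (Sh : ml_rule R M A K).

Lemma expectation_sum_indic (d : measure_display) (Omega : measurableType d)
    (P : probability Omega R) (B : nat) (E : nat -> set Omega) (x : R) :
  0 <= x -> (forall n, measurable (E n)) ->
  (\int[P]_w (x + \sum_(n < B) \1_(E n) w)%:E = x%:E + \sum_(n < B) P (E n))%E.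
Proof.
move=> x0 mE; under eq_integral do rewrite EFinD -sumEFin.
rewrite ge0_integralD//=; last 2 first.
- by move=> w _; rewrite sume_ge0.
- apply: emeasurable_sum => n; apply/measurable_EFinP; exact: measurable_indic.
rewrite integral_cst//; congr (_ + _)%E.
  by rewrite -[RHS]mule1; congr (_ * _)%E; exact: probability_setT.
rewrite ge0_integral_sum//; last first.
  by move=> n; apply/measurable_EFinP; exact: measurable_indic.
by apply: eq_bigr => n _; rewrite integral_indic// setIT.
Qed.

(** The test stops at the first time after about [ln T / (a - e)] at which the
    empirical distributions are close to the true ones. *)
Lemma expected_stop_le S (a e : R) : nonnull K S -> 0 < e -> e < a ->
  (forall S', nonnull K S' -> S' != S -> a <= split_div (law mu pi S) S') ->
  exists C : R, forall Sh (d : measure_display) (Omega : measurableType d)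
    (P : {set 'I_M} -> probability Omega R) (Y : Omega -> path M A),
  outlier_model K mu pi P Y -> forall T F, 1 <= T ->
  ('E_(P S)[fun w => (N_star Sh T F (Y w))%:R] <= (ln T / (a - e) + C)%:E)%E.
Proof.
move=> nS e0 ea ha; have /andP[hS _] := nS.
have e2 : 0 < e / 2 by rewrite divr_gt0.
have [dl dl0 hdl] := @exists_deviation R M A _ e2.
have b0 : 0 < dl ^+ 2 / 8 by rewrite divr_gt0// exprn_gt0.
have [C1 C10 hC1] := pow_expR_le (M * #|A|) b0.
have [C2 C20 hC2] := ln_le_linear (M.+1 * #|A|) e2.
have ae : 0 < a - e by rewrite subr_gt0.
set r := expR (- (dl ^+ 2 / 8)) in hC1.
have r1 : 0 <= r < 1.
  by rewrite expR_ge0 -[ltRHS]expR0 ltr_expR oppr_lt0.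
exists (C2 / (a - e) + 1 + C1 / (1 - r)).
move=> Sh d Omega P Y HY T F T1.
set B := Num.truncn F.
have lnT : 0 <= ln T by rewrite ln_ge0.
(* After time [n1] the threshold is below [n * (a - e / 2)]: the logarithmic
   term costs at most [C2 + e / 2 * n]. *)
set n1 := (ln T + C2) / (a - e).
have n10 : 0 <= n1 by apply: divr_ge0; [exact: addr_ge0|exact: ltW].
set m := (Num.truncn n1).+1.
pose ex n (y : obs M A n) := (0 < n)%N && far dl (law mu pi S) y.
pose E n := [set w | ex n (prefix n (Y w))].
have mE n : measurable (E n) by exact: (measurable_prefix HY (@ex n)).
have count w : (N_star Sh T F (Y w) <= m + \sum_(n < B) ex n (prefix n (Y w)))%N.
  apply: (count_exceptions (e := fun n => ex n (prefix n (Y w)))); first exact: N_star_le.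
  move=> n mn nN; have n0 : (0 < n)%N by apply: leq_trans mn.
  rewrite /ex n0; apply: contraNT (N_star_not_crosses nN) => nf.
  apply: (near_crosses hKM hmu hpi Sh n0 nS nf ha); first by lra.
  have nn1 : n1 < n%:R.
    by apply: lt_le_trans (truncnS_gt _) _; rewrite ler_nat.
  apply: (@le_lt_trans _ _ (ln T + C2 + e / 2 * n%:R)).
    by have := hC2 n; rewrite /threshold; lra.
  apply: (@lt_le_trans _ _ (n%:R * (a - e / 2))); last by rewrite ler_wpM2l//; lra.
  by move: nn1; rewrite /n1 ltr_pdivrMr//; lra.
have pE n : (P S (E n) <= (C1 * r ^+ n)%:E)%E.
  case: n => [|n].
    rewrite (_ : E 0%N = set0) ?measure0 ?lee_fin ?mulr_ge0 ?exprn_ge0 ?(ltW C10)//.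
      by case/andP: r1.
    by apply/seteqP; split=> w.
  apply: (le_trans (prob_not_near hmu hpi HY hS (ltn0Sn n) (ltW dl0))).
  rewrite lee_fin; apply: le_trans (hC1 n.+1).
  by rewrite (_ : _ * (_ / 4) = 2 * (dl ^+ 2 / 8) * n.+1%:R)//; field.
rewrite unlock; apply: (@le_trans _ _ (\int[P S]_w (n1 + 1 + \sum_(n < B) \1_(E n) w)%:E)%E).
  apply: ge0_le_integral => //.
  - apply/measurable_EFinP.
    have dN : determined B (fun x => (N_star Sh T F x)%:R : R).
      by move=> x y /N_star_determined ->.
    exact: (measurable_fun_determined HY dN).
  - apply/measurable_EFinP; apply: measurable_funD; first exact: measurable_cst.
    by apply: measurable_sum => n; exact: measurable_indic.
  move=> w _; rewrite lee_fin.
  apply: (@le_trans _ _ (m + \sum_(n < B) ex n (prefix n (Y w)))%N%:R).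
    by rewrite ler_nat count.
  rewrite natrD natr_sum lerD//.
    by rewrite /m -natr1 lerD2r truncn_le.
  apply: ler_sum => n _; rewrite indicE; case h: (ex n _) => //.
  by rewrite mem_set.
rewrite expectation_sum_indic//; last by rewrite addr_ge0.
apply: (@le_trans _ _ ((n1 + 1)%:E + \sum_(n < B) (C1 * r ^+ n)%:E)%E).
  by rewrite leeD2l//; apply: lee_sum.
rewrite sumEFin -EFinD lee_fin -mulr_sumr.
have : C1 * \sum_(n < B) r ^+ n <= C1 / (1 - r).
  by rewrite ler_pM2l// geometric_sum_le.
rewrite /n1 mulrDl; lra.
Qed.

End expected_duration.

(** * Maximal error probability *)

Section maximal_error.
Context {R : realType} {M : nat} {A : finType} (K : nat).
Variables (mu pi : A -> R) (hmu : pmf mu) (hpi : pmf pi).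
Context (d : measure_display) (Omega : measurableType d).
Variables (P : {set 'I_M} -> probability Omega R) (Y : Omega -> path M A).
Hypothesis HY : outlier_model K mu pi P Y.
Variables (Sh : ml_rule R M A K) (T F : R).

Let error S := [set w | delta_star Sh T F (Y w) <> S].

Lemma measurable_error S : measurable (error S).
Proof.
apply: (measurable_determined HY (n := Num.truncn F) (Q := fun x => delta_star Sh T F x <> S)).
by move=> x y /delta_star_determined ->.
Qed.

Lemma P_max_ge0 : 0 <= P_max P Y (universal_test Sh T F).
Proof. exact: bigmax_ge_id. Qed.

Lemma P_max_le (x : R) : 0 <= x ->
  (forall S, hypothesis K S -> (P S (error S) <= x%:E)%E) ->
  P_max P Y (universal_test Sh T F) <= x.
Proof.
move=> x0 h; apply/bigmax_leP; split=> // S hS.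
rewrite -lee_fin fineK; first exact: h.
by apply: fin_num_measure; exact: measurable_error.
Qed.

(** With full support no decision based on finitely many observations is
    certain, hence [ln] of the error probability is meaningful. *)
Lemma P_max_gt0 : (0 < K)%N -> (0 < M)%N -> full_support mu -> full_support pi ->
  0 < P_max P Y (universal_test Sh T F).
Proof.
move=> K0 M0 fmu fpi.
have [w0 _] : exists w, [set: Omega] w.
  apply/set0P/eqP => O0; have := probability_setT (P finset.set0).
  by rewrite O0 measure0 => /eqP; rewrite eqe eq_sym oner_eq0.
(* On the cylinder of the path [Y w0] the decision is constant, hence wrong
   under some hypothesis. *)
have [S [hS dS]] : exists S, hypothesis K S /\ delta_star Sh T F (Y w0) <> S.
  have [e|ne] := pselect (delta_star Sh T F (Y w0) = finset.set0); last first.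
    by exists finset.set0; rewrite /hypothesis cards0.
  exists [set Ordinal M0]%SET; rewrite /hypothesis cards1; split=> //.
  rewrite e => /setP/(_ (Ordinal M0)); by rewrite !inE eqxx.
set y0 := prefix (Num.truncn F) (Y w0).
apply: (@lt_le_trans _ _ (fine (P S (error S)))); last first.
  by apply: (le_bigmax_cond 0 (fun S => fine (P S (error S)))).
rewrite -lte_fin fineK; last by apply: fin_num_measure; exact: measurable_error.
apply: (@lt_le_trans _ _ (P S [set w | prefix (Num.truncn F) (Y w) = y0])).
  rewrite (model_law HY)// joint_pmfE lte_fin.
  apply: prodr_gt0 => k _; apply: prodr_gt0 => i _.
  by rewrite /law; case: ifP.
apply: le_measure; rewrite ?inE.
- exact: (measurable_cylinder HY).
- exact: measurable_error.
by move=> w /= /delta_star_determined; rewrite /error /= => ->.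
Qed.

End maximal_error.

Section consistency.
Context {R : realType} {M : nat} {A : finType} (K : nat).
Hypotheses (hK : (2 < K)%N) (hKM : (2 * K < M)%N).
Variables (mu pi : A -> R) (hmu : pmf mu) (hpi : pmf pi) (neq : mu <> pi).

Lemma P_max_O_inv (c T0 : R) : 0 < c ->
  exists2 C : R, 0 <= C & forall (Sh : ml_rule R M A K) (f : R -> R),
  grows_TlogT c T0 f ->
  forall (d : measure_display) (Omega : measurableType d)
    (P : {set 'I_M} -> probability Omega R) (Y : Omega -> path M A),
  outlier_model K mu pi P Y -> forall T, 0 < T ->
  P_max P Y (universal_test Sh T (f T)) <= C / T.
Proof.
move=> c0.
have /choice[C hC] : forall S : {set 'I_M}, exists C : R, 0 <= C /\
  (hypothesis K S -> forall (Sh : ml_rule R M A K) (f : R -> R), grows_TlogT c T0 f ->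
  forall (d : measure_display) (Omega : measurableType d)
    (P : {set 'I_M} -> probability Omega R) (Y : Omega -> path M A),
  outlier_model K mu pi P Y -> forall T, 0 < T ->
  (P S [set w | delta_star Sh T (f T) (Y w) <> S] <= (C / T)%:E)%E).
  move=> S; have [hS|nS] := boolP (hypothesis K S); last by exists 0.
  have [C C0 hC] := prob_error_O_inv hK hKM hmu hpi neq T0 c0 hS.
  by exists C.
exists (\sum_S C S); first by apply: sumr_ge0 => S _; case: (hC S).
move=> Sh f hf d Omega P Y HY T Tp; apply: (P_max_le HY).
  by rewrite divr_ge0 ?(ltW Tp)// sumr_ge0// => S _; case: (hC S).
move=> S hS; have [_ /(_ hS Sh f hf d Omega P Y HY T Tp) h] := hC S.
apply: (le_trans h); rewrite lee_fin ler_wpM2r ?invr_ge0 ?(ltW Tp)//.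
by rewrite (bigD1 S)//= lerDl sumr_ge0// => S' _; case: (hC S').
Qed.

End consistency.

(** * Asymptotics *)

Section asymptotics.
Context {R : realType}.

Lemma near_ln_ge (x : R) : \forall T \near +oo, x <= ln T.
Proof.
have := nbhs_pinfty_ge (num_real (expR x)); apply: filterS => T hT.
by rewrite -ler_expR lnK// posrE (lt_le_trans (expR_gt0 x)).
Qed.

Lemma cvg_ln_ratio (k : R) : ln T / (ln T - k) @[T --> +oo] --> (1 : R).
Proof.
apply/cvgrPdist_le => eps eps0.
have := near_ln_ge (k + `|k| / eps + 1); apply: filterS => T hT.
have q0 : 0 <= `|k| / eps by rewrite divr_ge0// ltW.
have den : 0 < ln T - k by lra.
have -> : 1 - ln T / (ln T - k) = - k / (ln T - k) by field; rewrite gt_eqF.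
rewrite normrM normrN normfV (gtr0_norm den) ler_pdivrMr//.
by rewrite mulrC -ler_pdivrMr//; lra.
Qed.

(** If [E] grows like [ln T / a] with arbitrarily small relative loss, and
    [p T = O(1/T)], then [E] is asymptotically at most [- ln p / eta] for every
    [eta <= a]. *)
Lemma asymptotic_bounds (E p : R -> R) (a eta C : R) :
  0 < eta -> eta <= a ->
  (forall e, 0 < e -> e < a -> exists D, forall T, 1 <= T -> E T <= ln T / (a - e) + D) ->
  (forall T, 0 < p T) -> (forall T, 0 < T -> p T <= C / T) ->
  exists e1 e2 : R -> R,
    [/\ e1 T @[T --> +oo] --> (0 : R), e2 T @[T --> +oo] --> (0 : R) &
    \forall T \near +oo, E T <= ln T / a * (1 + e1 T) /\
      ln T / a * (1 + e1 T) <= - ln (p T) / eta * (1 + e2 T)].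
Proof.
move=> eta0 etaa hE p0 pC; have a0 : 0 < a by apply: lt_le_trans etaa.
have C0 : 0 < C by have := pC 1 ltr01; rewrite divr1; apply: lt_le_trans.
pose e1 T := Num.max 0 (a * E T / ln T - 1).
(* [e2] is chosen so that [(ln T - ln C) * (1 + e2 T) = ln T * (1 + e1 T)]. *)
pose e2 T := (1 + e1 T) * (ln T / (ln T - ln C)) - 1.
have e1_ge0 T : 0 <= e1 T by rewrite le_max lexx.
have e1_0 : e1 T @[T --> +oo] --> (0 : R).
  apply/cvgrPdist_le => eps eps0.
  (* The loss [e] for which [a / (a - e) = 1 + eps / 2]. *)
  set e := a - a / (1 + eps / 2).
  have h1 : 0 < 1 + eps / 2 by lra.
  have ee : a - e = a / (1 + eps / 2) by rewrite /e opprB addrCA subrr addr0.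
  have aq : a / (1 + eps / 2) < a by rewrite ltr_pdivrMr// ltr_pMr//; lra.
  have aq0 : 0 < a / (1 + eps / 2) by rewrite divr_gt0.
  have [||D hD] := hE e; [by rewrite /e subr_gt0|by rewrite /e; lra|].
  near=> T.
  have lnT1 : 1 <= ln T by near: T; exact: near_ln_ge.
  have lnT2 : 2 * a * `|D| / eps <= ln T by near: T; exact: near_ln_ge.
  have lnTp : 0 < ln T by apply: lt_le_trans lnT1.
  have T1 : 1 <= T by near: T; exact: nbhs_pinfty_ge (num_real _).
  rewrite sub0r normrN ger0_norm// ge_max (ltW eps0)/= lerBlDr ler_pdivrMr//.
  have hl : 2 * (a * `|D|) <= eps * ln T.
    by move: lnT2; rewrite ler_pdivrMr// (mulrC (ln T)) mulrA.
  have hDn : a * D <= a * `|D| by rewrite ler_pM2l// ler_norm.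
  have := hD T T1; rewrite ee -(ler_pM2l a0).
  rewrite (_ : a * (ln T / (a / (1 + eps / 2)) + D) =
    ln T * (1 + eps / 2) + a * D); first by lra.
  by field; rewrite !gt_eqF//; lra.
exists e1, e2; split=> //.
  rewrite (_ : (0 : R) = (1 + 0) * 1 - 1); last by lra.
  apply: cvgB; last exact: cvg_cst.
  apply: cvgM; last exact: cvg_ln_ratio.
  by apply: cvgD => //; exact: cvg_cst.
near=> T.
have lnT1 : 1 <= ln T by near: T; exact: near_ln_ge.
have lnT2 : ln C + 1 <= ln T by near: T; exact: near_ln_ge.
have Tp : 0 < T by near: T; exact: nbhs_pinfty_gt (num_real _).
have lnTp : 0 < ln T by apply: lt_le_trans lnT1.
have den : 0 < ln T - ln C by lra.
split.
  have : a * E T / ln T - 1 <= e1 T by rewrite le_max lexx orbT.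
  rewrite lerBlDr ler_pdivrMr// => h.
  by rewrite mulrAC ler_pdivlMr// mulrC (mulrC (ln T)) [1 + _]addrC.
have lp : ln T - ln C <= - ln (p T).
  have : ln (p T) <= ln (C / T) by rewrite ler_ln ?posrE ?divr_gt0//; exact: pC.
  by rewrite ln_div ?posrE//; lra.
have -> : 1 + e2 T = (1 + e1 T) * (ln T / (ln T - ln C)) by rewrite /e2; lra.
have e1p : 0 <= 1 + e1 T by rewrite addr_ge0.
apply: (@le_trans _ _ (ln T / eta * (1 + e1 T))).
  by rewrite ler_wpM2r// ler_wpM2l ?(ltW lnTp)// lef_pV2 ?posrE.
rewrite (mulrC (1 + e1 T)) mulrA ler_wpM2r// mulrAC ler_wpM2r ?invr_ge0 ?(ltW eta0)//.
by rewrite mulrA ler_pdivlMr// mulrC ler_wpM2r// ltW.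
Unshelve. all: by end_near.
Qed.

End asymptotics.

Theorem theorem3 (R : realType) (A : finType) (M K : nat) (c T0 : R)
    (hM : (3 <= M)%N) (hK : (2 < K)%N) (hKM : (2 * K < M)%N) (hc : 0 < c) :
  (forall (Sh : ml_rule R M A K) (f : R -> R), grows_TlogT c T0 f ->
     universally_consistent (fun T => universal_test Sh T (f T)))
  /\
  forall mu pi : A -> R, pmf mu -> pmf pi ->
    full_support mu -> full_support pi -> mu <> pi ->
  (forall S : {set 'I_M}, nonnull K S -> 0 < fine (alpha_bar K mu pi S))
  /\
  exists C : R,
  forall (Sh : ml_rule R M A K) (f : R -> R), grows_TlogT c T0 f ->
  forall (d : measure_display) (Omega : measurableType d)
    (P : {set 'I_M} -> probability Omega R) (Y : Omega -> path M A),
    outlier_model K mu pi P Y ->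
  let test T := universal_test Sh T (f T) in
  let Pmax T := P_max P Y (test T) in
  (forall T : R, 0 < T -> Pmax T <= C / T)
  /\
  forall S : {set 'I_M}, nonnull K S ->
  exists e1 e2 : R -> R,
    [/\ e1 T @[T --> +oo] --> (0 : R), e2 T @[T --> +oo] --> (0 : R) &
    \forall T \near +oo,
      ('E_(P S)[fun w => (stop (test T) (Y w))%:R]
         <= (ln T / fine (alpha_bar K mu pi S) * (1 + e1 T))%:E)%E
      /\
      ln T / fine (alpha_bar K mu pi S) * (1 + e1 T)
        <= - ln (Pmax T) /
           (if #|S| == K then fine (eta_bar K mu pi S)
            else Num.min (fine (eta_bar K mu pi S)) (fine (eta mu pi S)))
           * (1 + e2 T)].
Proof.
split.
  move=> Sh f hf mu pi hmu hpi neq d Omega P Y HY.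
  have [C C0 hC] := P_max_O_inv hK hKM hmu hpi neq T0 hc.
  apply/cvgrPdist_le => eps eps0; near=> T.
  have Tp : 0 < T by near: T; exact: nbhs_pinfty_gt (num_real _).
  have TC : C / eps <= T by near: T; exact: nbhs_pinfty_ge (num_real _).
  rewrite sub0r normrN ger0_norm ?P_max_ge0//.
  rewrite (le_trans (hC Sh f hf d Omega P Y HY T Tp))//.
  by rewrite ler_pdivrMr// mulrC -ler_pdivrMr.
move=> mu pi hmu hpi fmu fpi neq; split.
  by move=> S hS; have [a [-> ]] := alpha_bar_attained hK hKM hmu hpi neq hS.
have [C C0 hC] := P_max_O_inv hK hKM hmu hpi neq T0 hc.
exists C => Sh f hf d Omega P Y HY test Pmax; split.
  by move=> T Tp; exact: hC.
move=> S hS; have [a [aE a0 ha [S' [hS' dS' aS']]]] := alpha_bar_attained hK hKM hmu hpi neq hS.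
have /andP[cS S0] := hS.
have [_ card_bar] := card_setC_gt0 hKM cS cS.
have [eb ebE eb0] := eta_inf_gt0 hmu hpi fmu neq (ltn0Sn 0) card_bar.
have [e eE e0] : exists2 e : R, eta mu pi S = e%:E & 0 < e.
  by rewrite etaE; apply: eta_inf_gt0; rewrite // card_gt0.
have := eta_le_split_div hmu hpi fmu fpi hKM hS hS' dS'; rewrite -aS' aE eta_barE ebE eE /=.
set eta0 := if _ then eb else _ => le_eta.
have eta0_gt0 : 0 < eta0 by rewrite /eta0; case: ifP => // _; rewrite lt_min eb0.
have eta0_le : eta0 <= a.
  move: le_eta; rewrite /eta0; case: ifP => _; first by rewrite lee_fin.
  by rewrite -EFin_min lee_fin.
pose E T := fine ('E_(P S)[fun w => (stop (test T) (Y w))%:R])%E.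
have E_ge0 T : (0 <= 'E_(P S)[fun w => (stop (test T) (Y w))%:R])%E.
  by apply: expectation_ge0 => w.
have E_fin T x : ('E_(P S)[fun w => (stop (test T) (Y w))%:R] <= x%:E)%E ->
    ('E_(P S)[fun w => (stop (test T) (Y w))%:R] = (E T)%:E)%E.
  by move=> h; rewrite fineK// ge0_fin_numE// (le_lt_trans h)// ltry.
have hE ee : 0 < ee -> ee < a ->
    exists D, forall T, 1 <= T -> E T <= ln T / (a - ee) + D.
  move=> ee0 eea; have [D hD] := expected_stop_le hKM hmu hpi hS ee0 eea ha.
  exists D => T T1; have h := hD Sh d Omega P Y HY T (f T) T1.
  by rewrite -lee_fin -(E_fin _ _ h).
have Pmax_gt0 T : 0 < Pmax T.
  by apply: (P_max_gt0 HY) => //; [apply: leq_trans hK|apply: leq_trans hM].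
have [e1 [e2 [h1 h2 h12]]] := asymptotic_bounds eta0_gt0 eta0_le hE Pmax_gt0
  (hC Sh f hf d Omega P Y HY).
exists e1, e2; split=> //.
have a2 : 0 < a / 2 by rewrite divr_gt0.
have a2a : a / 2 < a by lra.
have [D hD] := expected_stop_le hKM hmu hpi hS a2 a2a ha.
near=> T.
have T1 : 1 <= T by near: T; exact: nbhs_pinfty_ge (num_real _).
have [hT1 hT2] : E T <= ln T / a * (1 + e1 T) /\
  ln T / a * (1 + e1 T) <= - ln (Pmax T) / eta0 * (1 + e2 T) by near: T.
split=> //.
by rewrite (E_fin _ _ (hD Sh d Omega P Y HY T (f T) T1)) lee_fin.
Unshelve. all: by end_near.
Qed.
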